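(* Let $f$ be an isomorphism-invariant monic multiplicative graph polynomial of linearly bounded exponential type, with associated constants $C$ and $c_k(F)$ and measures $\nu_{G,d}$ as in the context. Let $d_n\to\infty$. Let $(G_n,d_n)$ be a convergent sequence, or, more generally, an admissible sequence such that $t(F,G_n,d_n)$ converges as $n\to\infty$ for every connected graph $F$ with $c_{\mathrm{v}(F)-1}(F)\ne 0$. Write $t(F)=\lim_{n\to\infty}t(F,G_n,d_n)$ for the limiting homomorphism density and set $\nu_n=\nu_{G_n,d_n}$. (1) For all $k\ge 0$, $\int z^k\,d\nu_n(z)\to\sum_{\mathrm{v}(F)=k+1}c_k(F)\,t(F)$ as $n\to\infty$, where the sum is over isomorphism classes of connected graphs $F$ with $k+1$ nodes (terms with $c_k(F)=0$ being $0$). (2) For any function $g(z)$ that is continuous for $|z|\le C$ and harmonic for $|z|<C$, the integral $\int g(z)\,d\nu_n(z)$ converges as $n\to\infty$. (3) For any $\xi\in\mathbb{C}$ with $|\xi|>C$, the normalized absolute value $\dfrac{|f(G_n,\xi d_n)|^{1/\mathrm{v}(G_n)}}{d_n}$ converges to a positive limit. (4) If $f(G_n,x)$ has only real roots for all $n$, then $\nu_n$ converges weakly.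
   Context: Graphs are finite, simple and undirected; $\mathrm{v}(F)$ and $\mathrm{c}(F)$ are the numbers of nodes and of connected components of $F$; $\hom(F,G)$ and $\mathrm{inj}(F,G)$ are the numbers of homomorphisms and of injective homomorphisms from $F$ to $G$. An admissible pair is a pair $(G,d)$ where $d\ge 1$ and $G$ is a graph with all degrees $\le d$; an admissible sequence is a sequence of admissible pairs. The homomorphism density is $t(F,G,d)=\hom(F,G)/\big(\mathrm{v}(G)^{\mathrm{c}(F)}d^{\,\mathrm{v}(F)-\mathrm{c}(F)}\big)\in[0,1]$. An admissible sequence $(G_n,d_n)$ is convergent if $t(F,G_n,d_n)$ converges for every graph $F$. An isomorphism-invariant monic multiplicative graph polynomial of linearly bounded exponential type is an assignment $G\mapsto f(G,x)$ such that: for every graph $G$, $f(G,x)\in\mathbb{C}[x]$ is monic of degree $\mathrm{v}(G)$; $f(G_1,x)=f(G_2,x)$ if $G_1\simeq G_2$; $f(G_1\cup G_2,x)=f(G_1,x)f(G_2,x)$ for any disjoint union; $f(G,x+y)=\sum_{S\subseteq V(G)}f(G[S],x)f(G[V(G)-S],y)$ for all $G$ (where $G[S]$ is the induced subgraph); and there is a constant $c$ depending only on $f$ such that $\sum\{|f'(G[S],0)| : v\in S\subseteq V(G),\ |S|=t\}\le (cd)^{t-1}$ for all $G$ with maximal degree $\le d$, all $v\in V(G)$ and all $t\ge 1$ (here $f'$ is the derivative in $x$). Known facts (Csikvári–Frenkel) used to fix notation: there is a constant $C$ depending only on $f$ such that for every graph $G$ with all degrees $\le d$ all roots of $f(G,x)$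 have absolute value $\le Cd$ (e.g. $C=7.04\,c$); fix such a $C$. Let $p_k(G)$ be the $k$-th power sum of the roots of $f(G,x)$ (with multiplicity). For each $k\ge 1$ there exist constants $c_k(F)$ such that $p_k(G)=\sum_{2\le \mathrm{v}(F)\le k+1}c_k(F)\,\mathrm{inj}(F,G)$ for all $G$, where $F$ runs over isomorphism classes of connected graphs; also $c_0(K_1)=1$, where $K_1$ is the one-node graph. For an admissible pair $(G,d)$, $\nu_{G,d}$ is the uniform probability measure on the $\mathrm{v}(G)$ points $\lambda/d$, where $\lambda$ runs over the roots of $f(G,x)$ with multiplicity. *)

(* Defs.v *)
From HB Require Import structures.
From mathcomp Require Import all_boot all_order all_algebra.
From mathcomp Require Import all_classical all_reals all_analysis.
From mathcomp Require Import complex.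

Set Implicit Arguments.
Unset Strict Implicit.
Unset Printing Implicit Defensive.

Import Order.TTheory GRing.Theory Num.Theory numFieldNormedType.Exports.

Local Open Scope classical_set_scope.
Local Open Scope ring_scope.
Local Open Scope complex_scope.

(* The library gives [R[i]^o] the topology of the modulus; transfer it to
   [R[i]] itself, as is already done for abstract numeric fields. *)
#[export, non_forgetful_inheritance]
HB.instance Definition _ (R : realType) := NormedModule.copy R[i] R[i]^o.

Record sgraph := SGraph {
  svert :> finType;
  sadj : rel svert;
  sadj_sym : symmetric sadj;
  sadj_irr : irreflexive sadj }.

Definition giso (G1 G2 : sgraph) : Prop :=
  exists2 h : G1 -> G2, bijective h &
    forall x y, sadj (h x) (h y) = sadj x y.

Definition gunion_adj (G1 G2 : sgraph) : rel (G1 + G2)%type := fun x y =>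
  match x, y with
  | inl a, inl b => sadj a b
  | inr a, inr b => sadj a b
  | _, _ => false
  end.

Fact gunion_sym (G1 G2 : sgraph) : symmetric (@gunion_adj G1 G2).
Proof. by move=> [x|x] [y|y] //=; exact: sadj_sym. Qed.

Fact gunion_irr (G1 G2 : sgraph) : irreflexive (@gunion_adj G1 G2).
Proof. by move=> [x|x] /=; exact: sadj_irr. Qed.

Definition gunion (G1 G2 : sgraph) : sgraph :=
  SGraph (@gunion_sym G1 G2) (@gunion_irr G1 G2).

Section Induced.
Variables (G : sgraph) (S : {set G}).

Definition induced_adj : rel {x : G | x \in S} :=
  fun x y => sadj (val x) (val y).

Fact induced_sym : symmetric induced_adj.
Proof. by move=> x y; exact: sadj_sym. Qed.

Fact induced_irr : irreflexive induced_adj.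
Proof. by move=> x; exact: sadj_irr. Qed.

Definition induced : sgraph := SGraph induced_sym induced_irr.

End Induced.

Definition ncomp (G : sgraph) : nat := n_comp (@sadj G) G.

(* The empty graph has no component, hence is not connected. *)
Definition gconnected (G : sgraph) : bool := ncomp G == 1%N.

Definition is_hom (F G : sgraph) (h : {ffun F -> G}) : bool :=
  [forall x, forall y, sadj x y ==> sadj (h x) (h y)].

Definition hom_num (F G : sgraph) : nat :=
  #|[set h : {ffun F -> G} | is_hom h]|.

Definition inj_num (F G : sgraph) : nat :=
  #|[set h : {ffun F -> G} | is_hom h & injectiveb h]|.

Definition degrees_le (R : realType) (G : sgraph) (d : R) : Prop :=
  forall x : G, #|[set y | sadj x y]|%:R <= d.

(* Labelled graphs on ['I_n], given by their (symmetric, irreflexive) sets of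
   ordered adjacent pairs; they form a finite type containing every graph with
   [n] nodes up to isomorphism. *)
Definition lgraph (n : nat) : finType :=
  {A : {set 'I_n * 'I_n} |
    [forall x, forall y, ((x, y) \in A) == ((y, x) \in A)]
    && [forall x, (x, x) \notin A]}.

Section LabelledGraph.
Variables (n : nat) (A : lgraph n).

Definition lgraph_adj : rel 'I_n := fun x y => (x, y) \in val A.

Fact lgraph_sym : symmetric lgraph_adj.
Proof.
by move=> x y; case/andP: (valP A) => /forallP/(_ x)/forallP/(_ y)/eqP.
Qed.

Fact lgraph_irr : irreflexive lgraph_adj.
Proof. by move=> x; case/andP: (valP A) => _ /forallP/(_ x)/negbTE. Qed.

Definition graph_of : sgraph := SGraph lgraph_sym lgraph_irr.

End LabelledGraph.

Definition conn_lgraphs (n : nat) : {set lgraph n} :=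
  [set A : lgraph n | gconnected (graph_of A)].

Definition conn_classes (n : nat) : {set lgraph n} :=
  transversal
    (equivalence_partition
       (fun A B : lgraph n => `[< giso (graph_of A) (graph_of B) >])
       (conn_lgraphs n))
    (conn_lgraphs n).

(* The degree bound [d] is a real number; integers are the special case
   [d = k%:R]. *)
Section Density.
Variable R : realType.
Implicit Types (F G : sgraph) (d : R).

Definition admissible G d : Prop :=
  [/\ (0 < #|G|)%N, 1 <= d & degrees_le G d].

Definition hom_density F G d : R :=
  (hom_num F G)%:R / (#|G|%:R ^+ ncomp F * d ^+ (#|F| - ncomp F)).

Definition admissible_seq (G : nat -> sgraph) (d : nat -> R) : Prop :=
  forall n, admissible (G n) (d n).

Definition convergent_seq (G : nat -> sgraph) (d : nat -> R) : Prop :=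
  forall F, cvgn (fun n => hom_density F (G n) (d n)).

Definition lim_density (G : nat -> sgraph) (d : nat -> R) F : R :=
  limn (fun n => hom_density F (G n) (d n)).

End Density.

Section GraphPolynomial.
Variable R : realType.
Implicit Types (f : sgraph -> {poly R[i]}) (G : sgraph).

Definition monic_graph_poly f : Prop :=
  forall G, f G \is monic /\ size (f G) = #|G|.+1.

Definition iso_invariant f : Prop :=
  forall G1 G2, giso G1 G2 -> f G1 = f G2.

Definition multiplicative f : Prop :=
  forall G1 G2, f (gunion G1 G2) = f G1 * f G2.

Definition exponential_type f : Prop :=
  forall G (x y : R[i]),
    (f G).[x + y] =
    \sum_(S : {set G}) (f (induced S)).[x] * (f (induced (~: S))).[y].

Definition linearly_bounded f : Prop :=
  exists c : R, forall G (d : R), degrees_le G d ->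
    forall (v : G) (t : nat), (1 <= t)%N ->
      \sum_(S : {set G} | (v \in S) && (#|S| == t))
        `|(f (induced S))^`().[0]| <= ((c * d) ^+ t.-1)%:C.

Definition lbet_graph_poly f : Prop :=
  [/\ monic_graph_poly f, iso_invariant f, multiplicative f,
      exponential_type f & linearly_bounded f].

(* [closed_field_poly_normal] factors [p] completely, so each root occurs in the
   list as often as its multiplicity. *)
Definition poly_roots (p : {poly R[i]}) : seq R[i] :=
  sval (closed_field_poly_normal p).

Definition root_bound f (C : R) : Prop :=
  forall G (d : R), degrees_le G d ->
    forall z, root (f G) z -> `|z| <= (C * d)%:C.

Definition power_sum f (k : nat) G : R[i] :=
  \sum_(z <- poly_roots (f G)) z ^+ k.

(* [c k F] stands for $c_k(F)$.  These equations determine [c k F] for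
   connected [F] with [2 <= #|F| <= k.+1], and for [k = 0], [#|F| = 1]; no other
   value is used. *)
Definition power_sum_coeffs f (c : nat -> sgraph -> R[i]) : Prop :=
  [/\ forall k F1 F2, giso F1 F2 -> c k F1 = c k F2,
      forall F : sgraph, #|F| = 1%N -> c 0%N F = 1 &
      forall k G, (1 <= k)%N ->
        power_sum f k G =
        \sum_(2 <= m < k.+2) \sum_(F in conn_classes m)
          c k (graph_of F) * (inj_num (graph_of F) G)%:R].

End GraphPolynomial.

Notation borelC R := (g_sigma_algebraType (@open R[i])).

Section Measures.
Variable R : realType.

Definition uniform_measure (s : seq R[i]) :
    {measure set (borelC R) -> \bar R} :=
  mscale ((size s)%:R^-1)%:nng
    (msum (fun j => dirac (s`_j : borelC R)) (size s)).

Definition root_measure (f : sgraph -> {poly R[i]}) (G : sgraph) (d : R) :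
    {measure set (borelC R) -> \bar R} :=
  uniform_measure [seq z / d%:C | z <- poly_roots (f G)].

(* [D] is [setT], or a set carrying [mu] on which [g] is well behaved: in a
   total setting, [g] may be arbitrary outside its intended domain. *)
Definition cintegral (mu : {measure set (borelC R) -> \bar R})
    (D : set (borelC R)) (g : R[i] -> R[i]) : R[i] :=
  (\int[mu]_(z in D) complex.Re (g z)) +i* (\int[mu]_(z in D) complex.Im (g z)).

Definition weakly_converges
    (mu : nat -> {measure set (borelC R) -> \bar R}) : Prop :=
  exists nu : probability (borelC R) R,
    forall h : R[i] -> R, continuous h ->
      (exists M : R, forall z, `|h z| <= M) ->
      (\int[mu n]_z h z) @[n --> \oo] --> \int[nu]_z h z.

Definition closed_disc (C : R) : set R[i] := [set z | `|z| <= C%:C].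

Definition open_disc (C : R) : set R[i] := [set z | `|z| < C%:C].

(* Harmonicity: twice continuously differentiable, in the sense that all second
   partial derivatives exist and are continuous, with vanishing Laplacian; the
   set [U] is meant to be open. *)
Definition harmonic2 (U : set (R * R)) (u : R * R -> R) : Prop :=
  let ex := (1, 0) : R * R in
  let ey := (0, 1) : R * R in
  (forall p v w, U p -> v \in [:: ex; ey] -> w \in [:: ex; ey] ->
    [/\ derivable u p v, derivable ('D_v u) p w &
        {for p, continuous ('D_w ('D_v u))}]) /\
  (forall p, U p -> 'D_ex ('D_ex u) p + 'D_ey ('D_ey u) p = 0).

Definition harmonic_on (U : set R[i]) (g : R[i] -> R[i]) : Prop :=
  let U2 := [set p : R * R | U (p.1 +i* p.2)] in
  harmonic2 U2 (fun p => complex.Re (g (p.1 +i* p.2))) /\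
  harmonic2 U2 (fun p => complex.Im (g (p.1 +i* p.2))).

End Measures.

(* Main.v *)
Require Import Defs.
From HB Require Import structures.
From mathcomp Require Import all_boot all_order all_algebra.
From mathcomp Require Import all_classical all_reals all_analysis.
From mathcomp Require Import complex measurable_realfun.
From mathcomp Require Import ring lra.
From mathcomp Require cyclic cyclotomic separable.

Set Implicit Arguments.
Unset Strict Implicit.
Unset Printing Implicit Defensive.

Import Order.TTheory GRing.Theory Num.Theory numFieldNormedType.Exports.
Import Normc.

Local Open Scope classical_set_scope.
Local Open Scope ring_scope.
Local Open Scope complex_scope.

(** Write [S n] for the sequence of the scaled roots [z / d n], which lie in the
    disc of radius [C]; integrals against the root measure are averages over
    [S n] ([Rintegral_uniform]).

    Moments. The average of [z^k] over [S n] is a combination, with coefficients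
    [c k F], of the ratios inj(F, G n) / (v(G n) (d n)^k) over connected [F] with
    at most [k + 1] nodes. A connected graph is mapped by choosing the image of
    one node freely and then every further node among at most [d n] neighbours
    ([card_hom_le]). So the ratio tends to [0] when [F] has fewer than [k + 1]
    nodes; and when [F] has exactly [k + 1] nodes, noninjective homomorphisms,
    which lose one free choice, are negligible and the ratio has the same limit as
    the homomorphism density ([moment_cvg]).

    Harmonic functions. Convergence of the moments gives convergence of the
    averages of [Re Q] for every polynomial [Q], hence of all uniform limits of
    such functions on the disc ([avg_approx_cvg]). A function continuous on the
    closed disc and harmonic inside is such a limit ([harmonic_poly_approx]): on
    the boundary circle it is approximated by trigonometric polynomials, here by
    convolution over roots of unity with the kernel [|1 + u|^(2 N)]
    ([circle_approx]), and the maximum principle extends the estimate to the disc.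
    The maximum principle only needs that the five-point discrete Laplacian is
    [o(t^2)] at each interior point ([discretely_harmonic]). For a twice
    differentiable harmonic function this is the mean value theorem; for
    [ln |xi - z|] it is the identity that the product of the [w - h] over the
    increments [h] equal to [t], [-t], [it], [-it] is [w^4 - t^4].

    Normalised absolute values. As [f] is the product over its roots, the
    normalised value at [xi d n] is the exponential of the average of
    [ln |xi - z|] over [S n], a function to which the previous part applies when
    [|xi| > C].

    Real roots. On real points, averages of polynomials in [Re z] converge, hence
    by the Weierstrass theorem averages of all continuous functions do
    ([avg_real_cvg]). The limit is a normalised positive functional on an interval.
    Its distribution function, an infimum over continuous majorants of the
    indicator of a half-line, defines a Lebesgue-Stieltjes measure, and comparing
    Riemann-Stieltjes sums shows that this measure represents the functional
    ([riesz_interval]). It is the weak limit of the root measures. *)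

(** * The modulus of a complex number *)

Section Modulus.
Variable R : realType.
Implicit Types z w : R[i].

Lemma normr_normc z : `|z| = (normc z)%:C.
Proof. by case: z. Qed.

Lemma normc_ge0 z : 0 <= normc z.
Proof. by rewrite -lecR -normr_normc; exact: normr_ge0. Qed.

Lemma sqr_normcE z : normc z ^+ 2 = complex.Re z ^+ 2 + complex.Im z ^+ 2.
Proof. by case: z => a b /=; rewrite sqr_sqrtr// addr_ge0 ?sqr_ge0. Qed.

Lemma normcX z n : normc (z ^+ n) = normc z ^+ n.
Proof. by elim: n => [|n ih]; rewrite ?normc1// !exprS normcM ih. Qed.

Lemma normc_conj z : normc z^* = normc z.
Proof. by case: z => a b /=; rewrite sqrrN. Qed.

Lemma normc_realc (x : R) : normc x%:C = `|x|.
Proof. by rewrite /= expr0n /= addr0 sqrtr_sqr. Qed.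

Lemma normc_le_Re z : `|complex.Re z| <= normc z.
Proof. by rewrite -lecR; exact: normc_ge_Re. Qed.

Lemma normc_le_Im z : `|complex.Im z| <= normc z.
Proof.
case: z => a b /=; rewrite -sqrtr_sqr ler_sqrt ?addr_ge0 ?sqr_ge0//.
by rewrite lerDr sqr_ge0.
Qed.

Lemma normc_le_ReIm z : normc z <= `|complex.Re z| + `|complex.Im z|.
Proof.
rewrite -(ler_pXn2r (n := 2))// ?nnegrE ?normc_ge0 ?addr_ge0//.
rewrite sqr_normcE sqrrD !real_normK ?num_real//.
by rewrite addrAC lerDl mulrn_wge0// mulr_ge0.
Qed.

Lemma normc_triangle z w : normc (z + w) <= normc z + normc w.
Proof. exact: le_normcD. Qed.

Lemma normcBC z w : normc (z - w) = normc (w - z).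
Proof. by rewrite -normcN opprB. Qed.

Lemma normc_eq0 z : (normc z == 0) = (z == 0).
Proof. by apply/eqP/eqP => [/eq0_normc//|->]; exact: normc0. Qed.

Lemma normc_sub_le z w : normc z - normc w <= normc (z - w).
Proof. by rewrite lerBlDr; apply: le_trans (normc_triangle _ _); rewrite subrK.
  Qed.

Lemma normc_sum (I : Type) (r : seq I) (P : pred I) (F : I -> R[i]) :
  normc (\sum_(i <- r | P i) F i) <= \sum_(i <- r | P i) normc (F i).
Proof.
elim/big_ind2 : _ => // [|x y z w xy zw]; first by rewrite normc0.
exact: le_trans (normc_triangle _ _) (lerD xy zw).
Qed.

Lemma cReD z w : complex.Re (z + w) = complex.Re z + complex.Re w.
Proof. by case: z w => a b [c d]. Qed.
Lemma cReN z : complex.Re (- z) = - complex.Re z.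
Proof. by case: z. Qed.
Lemma cReB z w : complex.Re (z - w) = complex.Re z - complex.Re w.
Proof. by rewrite cReD cReN. Qed.
Lemma cReM z w :
  complex.Re (z * w) = complex.Re z * complex.Re w - complex.Im z * complex.Im
    w.
Proof. by case: z w => a b [c d]. Qed.
Lemma cReZ (a : R) z : complex.Re (a%:C * z) = a * complex.Re z.
Proof. by rewrite cReM /= mul0r subr0. Qed.
Lemma cReZr (a : R) z : complex.Re (z * a%:C) = complex.Re z * a.
Proof. by rewrite mulrC cReZ mulrC. Qed.
Lemma cRe_sum (I : Type) (r : seq I) (P : pred I) (F : I -> R[i]) :
  complex.Re (\sum_(i <- r | P i) F i) = \sum_(i <- r | P i) complex.Re (F i).
Proof. by elim/big_ind2 : _ => // x y z w <- <-; rewrite cReD. Qed.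
Lemma cImD z w : complex.Im (z + w) = complex.Im z + complex.Im w.
Proof. by case: z w => a b [c d]. Qed.
Lemma cIm_sum (I : Type) (r : seq I) (P : pred I) (F : I -> R[i]) :
  complex.Im (\sum_(i <- r | P i) F i) = \sum_(i <- r | P i) complex.Im (F i).
Proof. by elim/big_ind2 : _ => // x y z w <- <-; rewrite cImD. Qed.
Lemma cImZr (a : R) z : complex.Im (z * a%:C) = complex.Im z * a.
Proof. by case: z => x y /=; rewrite mulr0 add0r. Qed.

Lemma poly_drop1E (Q : {poly R[i]}) : Q = drop_poly 1 Q * 'X + (Q`_0)%:P.
Proof.
apply/polyP => -[|i]; rewrite coefD coefMX coefC coef_drop_poly /= ?add0r//.
by rewrite addr0 addn1.
Qed.

Lemma horner_bounded (Q : {poly R[i]}) : exists2 M : R, 0 <= M &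
  forall z, normc z <= 1 -> normc Q.[z] <= M.
Proof.
exists (\sum_(i < size Q) normc Q`_i); first by apply: sumr_ge0 => i _; exact:
  normc_ge0.
move=> z z1; rewrite horner_coef (le_trans (normc_sum _ _ _))// ler_sum//
  => i _.
by rewrite normcM normcX ler_piMr ?normc_ge0// exprn_ile1 ?normc_ge0.
Qed.

Lemma horner_shift (Q : {poly R[i]}) z w : Q.[z + w] = (Q \Po ('X + z%:P)).[w].
Proof. by rewrite horner_comp !hornerE addrC. Qed.

End Modulus.

(** * Trigonometric approximation on a circle *)

Section TrigonometricApproximation.
Variable R : realType.
Implicit Types (z w u v : R[i]) (Q : {poly R[i]}).

Lemma complex_prim_root n : (0 < n)%N -> exists w : R[i], n.-primitive_root w.
Proof.
move=> n_gt0; pose p : {poly R[i]} := 'X^n - 1.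
have [r Dp] := closed_field_poly_normal p.
rewrite (monicP _) ?monicXnsubC // scale1r in Dp.
have rn1 : all n.-unity_root r by apply/allP=> z; rewrite -root_prod_XsubC -Dp.
have sz_r : (n < (size r).+1)%N.
  by rewrite -(size_prod_XsubC r id) -Dp size_XnsubC.
have [|z] := hasP (cyclic.has_prim_root n_gt0 rn1 _ sz_r); last by exists z.
rewrite -separable.separable_prod_XsubC -Dp.
by rewrite cyclotomic.separable_Xn_sub_1 // pnatr_eq0 -lt0n.
Qed.

Lemma normc_unity n w : (0 < n)%N -> w ^+ n = 1 -> normc w = 1.
Proof.
move=> n0 /(congr1 (@normc R)); rewrite normcX normc1 => /eqP.
by rewrite pexprn_eq1 ?normc_ge0// eqn0Ngt n0 /= => /eqP.
Qed.

Lemma sum_prim_root n w k : n.-primitive_root w -> (0 < k < n)%N ->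
  \sum_(j < n) (w ^+ j) ^+ k = 0.
Proof.
move=> pw /andP[k0 kn]; have wk1 : w ^+ k != 1.
  apply/eqP; rewrite -(expr0 w) => /eqP.
  by rewrite (eq_prim_root_expr pw) mod0n modn_small// eqn0Ngt k0.
apply: (mulfI (x := w ^+ k - 1)); first by rewrite subr_eq0.
rewrite mulr0; under eq_bigr do rewrite exprAC.
by rewrite -subrX1 -exprM mulnC exprM (prim_expr_order pw) expr1n subrr.
Qed.

(** Sampling at the [n]-th roots of unity recovers the exact mean of a
    polynomial of degree less than [n] over a circle, since every nontrivial
    power of a primitive root sums to zero. *)
Lemma sum_horner_prim_root n w Q z : n.-primitive_root w -> (size Q <= n)%N ->
  \sum_(j < n) Q.[z * w ^+ j] = n%:R * Q`_0.
Proof.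
move=> pw sQ; have n0 := prim_order_gt0 pw.
under eq_bigr do rewrite (horner_coef_wide _ sQ).
rewrite exchange_big /=; case: n n0 pw sQ => // n _ pw sQ.
rewrite big_ord_recl /= [X in _ + X]big1 ?addr0 => [|i _].
  by under eq_bigr do rewrite expr0 mulr1; rewrite sumr_const card_ord
    mulr_natl.
under eq_bigr do rewrite exprMn mulrCA.
by rewrite -mulr_sumr -mulr_sumr (sum_prim_root pw) ?mulr0//= /bump /=
  add1n ltnS ltn_ord.
Qed.

Lemma normc1D u : normc u = 1 -> normc (1 + u) ^+ 2 = 2 + 2 * complex.Re u.
Proof.
move=> u1; have := sqr_normcE u; rewrite u1 !sqr_normcE cReD cImD /=.
by case: u {u1} => a b /= ?; nra.
Qed.

(** On the unit circle multiplication by [|1 + u|^2 = 2 + u + u^*] maps real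
    parts of polynomials to real parts of polynomials, because
    [u^* u^k = u^(k-1)] there. *)
Lemma cos_kernel N : exists2 Q : {poly R[i]}, (size Q <= N.+1)%N &
  forall u, normc u = 1 -> complex.Re Q.[u] = normc (1 + u) ^+ N.*2.
Proof.
elim: N => [|N [Q sQ QE]].
  by exists 1 => [|u _]; rewrite ?size_poly1// hornerC expr0.
have DQ := poly_drop1E Q.
exists (2 *: Q + Q * 'X + drop_poly 1 Q + (Q`_0)^*%C *: 'X).
  have sX : (size (Q * 'X)%R <= N.+2)%N.
    by rewrite (leq_trans (size_polyMleq _ _))// size_polyX addn2.
  have sD (p p' : {poly R[i]}) : (size p <= N.+2)%N -> (size p' <= N.+2)%N ->
      (size (p + p')%R <= N.+2)%N.
    by move=> sp sp'; rewrite (leq_trans (size_polyD _ _))// geq_max sp.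
  apply: (sD); last by rewrite (leq_trans (size_scale_leq _ _)) ?size_polyX.
  apply: (sD); last by rewrite size_drop_poly (leq_trans (leq_subr _ _))// leqW.
  by apply: (sD) => //; rewrite (leq_trans (size_scale_leq _ _))// leqW.
move=> u u1; rewrite doubleS -(addn2 N.*2) exprD -QE// normc1D//.
rewrite !(hornerD, hornerZ, hornerM, hornerX) !cReD.
have uu : complex.Re u ^+ 2 + complex.Im u ^+ 2 = 1.
  by rewrite -sqr_normcE u1 expr1n.
have -> : complex.Re (2 * Q.[u]) = 2 * complex.Re Q.[u].
  by rewrite mulr_natl mulr2n cReD mulr_natl mulr2n.
rewrite [in 2 * _]DQ [in _ * u]DQ [in RHS]DQ.
rewrite !(hornerD, hornerM, hornerX, hornerC).
move: (_.[u]) (Q`_0) uu => [a b] [c e]; case: u {u1} => x y /=.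
move=> xy; have axy : a * (x ^+ 2 + y ^+ 2) = a by rewrite xy mulr1.
lra.
Qed.

Lemma natmul_geometric_small (r e : R) : 0 <= r < 1 -> 0 < e ->
  exists N, N.+1%:R * r ^+ N <= e.
Proof.
move=> /andP[r0 r1] e0; have [->|rn0] := eqVneq r 0.
  by exists 1%N; rewrite expr1 mulr0 ltW.
have rp : 0 < r by rewrite lt_neqAle eq_sym rn0.
pose s := Num.sqrt r; have sp : 0 < s by rewrite sqrtr_gt0.
have s2 : s ^+ 2 = r by rewrite sqr_sqrtr.
have s1 : s < 1 by rewrite -(ltr_pXn2r (n := 2))// ?nnegrE ?ltW// s2 expr1n.
have : (fun n => 1 * s ^+ n) @ \oo --> (0 : R).
  by apply: cvg_geometric; rewrite ger0_norm ?ltW.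
have h0 : 0 < s^-1 - 1 by rewrite subr_gt0 invf_gt1.
set h := s^-1 - 1 in h0; pose m := Num.min 1 h.
have m0 : 0 < m by rewrite lt_min ltr01.
move=> /cvgrPdist_le /(_ (e * m)) /(_ (mulr_gt0 e0 m0)) [N _ /(_ N (leqnn N))].
rewrite /= sub0r normrN mul1r ger0_norm ?exprn_ge0 ?(ltW sp)// => sN.
exists N; have bern : N.+1%:R * m * s ^+ N <= 1.
  have : 1 + N%:R * h <= (1 + h) ^+ N.
    elim: (N) => [|k ih]; first by rewrite mul0r addr0 expr0.
    rewrite exprS -natr1 mulrDl mul1r.
    apply: (@le_trans _ _ ((1 + h) * (1 + k%:R * h))); last first.
      by rewrite ler_wpM2l// addr_ge0// ltW.
    rewrite -subr_ge0; have -> : (1 + h) * (1 + k%:R * h) - (1 + (k%:R * h +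
      h)) = k%:R * h ^+ 2 by ring.
    by rewrite mulr_ge0// sqr_ge0.
  have -> : 1 + h = s^-1 by rewrite /h addrC subrK.
  rewrite exprVn -ler_pdivlMr ?exprn_gt0// div1r.
  apply: le_trans; rewrite -natr1 mulrDl mul1r addrC lerD//.
    by rewrite ge_min lexx.
  by rewrite ler_wpM2l// ge_min lexx orbT.
rewrite -s2 -exprM mulnC exprM expr2.
rewrite -(ler_pM2r m0); apply: le_trans sN.
rewrite [leLHS](_ : _ = N.+1%:R * m * s ^+ N * s ^+ N); last by ring.
by rewrite ler_piMl// exprn_ge0// ltW.
Qed.

Definition circle_ucont (C : R) (phi : R[i] -> R) := forall e : R, 0 < e ->
  exists2 del : R, 0 < del & forall z w, normc z = C -> normc w = C ->
    normc (z - w) < del -> `|phi z - phi w| <= e.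

(** Convolve [phi] over the [N + 1]-st roots of unity with the kernel
    [|1 + u|^(2 N)]. By [sum_horner_prim_root] its total mass does not depend on
    the point, and this mass is at least [4^N], whereas the kernel is at most
    [(4 - del^2)^N] at distance [del] from its peak; the [N + 1] nodes are
    harmless since [(N + 1) r^N] tends to [0]. *)
Lemma unit_circle_approx (phi : R[i] -> R) (B : R) :
  (forall z, normc z = 1 -> `|phi z| <= B) -> circle_ucont 1 phi ->
  forall e : R, 0 < e ->
  exists Q : {poly R[i]}, forall z, normc z = 1 ->
    `|phi z - complex.Re Q.[z]| <= e.
Proof.
move=> phiB uphi e e0.
have B0 : 0 <= B by apply: le_trans (phiB 1 _); rewrite ?normc1.
have [|del' del'0 hdel'] := uphi (e / 2); first by rewrite divr_gt0.
pose del := Num.min 1 del'.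
have del0 : 0 < del by rewrite lt_min ltr01.
have del1 : del <= 1 by rewrite ge_min lexx.
(* [|1 + u|^2 = 4 - |1 - u|^2] on the circle, so [4 r] bounds it at distance at
   least [del] from [1]. *)
pose r := 1 - del ^+ 2 / 4.
have r01 : 0 <= r < 1.
  by apply/andP; rewrite /r; split; nra.
have [|N hN] := @natmul_geometric_small r (e / (4 * B + 1)) r01.
  by rewrite divr_gt0// ltr_wpDl// mulr_ge0.
have [q sq qE] := cos_kernel N.
have [om pom] := complex_prim_root (ltn0Sn N).
pose v (j : 'I_N.+1) := om ^+ j; pose w j := (v j)^*%C.
have om1 : normc om = 1 by apply: (normc_unity (ltn0Sn N)); apply:
  prim_expr_order.
have v1 j : normc (v j) = 1 by rewrite normcX om1 expr1n.
have w1 j : normc (w j) = 1 by rewrite normc_conj.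
pose K z j := normc (1 + z * v j) ^+ N.*2.
have K0 z j : 0 <= K z j by rewrite exprn_ge0 ?normc_ge0.
pose a := N.+1%:R * complex.Re q`_0.
have zv1 z j : normc z = 1 -> normc (z * v j) = 1 by move=> z1;
  rewrite normcM z1 v1 mulr1.
have sumK z : normc z = 1 -> \sum_j K z j = a.
  move=> z1; rewrite /a mulr_natl -raddfMn /= -mulr_natl.
  rewrite -(sum_horner_prim_root z pom sq) cRe_sum.
  by apply: eq_bigr => j _; rewrite qE// zv1.
(* The node [1] alone contributes [4^N] to the mass at [z = 1]. *)
have a4 : 4 ^+ N <= a.
  rewrite -(sumK 1) ?normc1// big_ord_recl /= ler_wpDr ?sumr_ge0//.
  rewrite /K /v expr0 mulr1 -[1 + 1]/(2%:R : R[i]) -(rmorph_nat (real_complex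
    R)).
  by rewrite normc_realc normr_nat -mul2n exprM (_ : 2%:R ^+ 2 = 4)//; ring.
have a0 : 0 < a by apply: lt_le_trans a4; rewrite exprn_gt0.
exists ((a^-1)%:C *: \sum_j (phi (w j))%:C *: (q \Po (v j *: 'X))) => z z1.
rewrite hornerZ horner_sum cReZ cRe_sum.
under eq_bigr do rewrite hornerZ cReZ horner_comp hornerZ hornerX qE ?[_ *
  z]mulrC ?zv1//.
have an0 : a != 0 by rewrite gt_eqF.
rewrite -[X in X - _](mulKf an0) -mulrBr.
rewrite normrM gtr0_norm ?invr_gt0// -[in a * _](sumK z z1) mulr_suml -sumrB.
rewrite ler_pdivrMl//.
apply: (le_trans (ler_norm_sum _ _ _)).
have step j : `|K z j * phi z - phi (w j) * K z j| <= e / 2 * K z j +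
  2 * B * (4 * r) ^+ N.
  rewrite [_ * K z j]mulrC -mulrBr normrM ger0_norm// mulrC.
  have [zw|zw] := ltP (normc (z - w j)) del.
    rewrite ler_wpDr//; last by rewrite ler_wpM2r// hdel'// (lt_le_trans zw)//
      ge_min lexx orbT.
    by rewrite !mulr_ge0// exprn_ge0// mulr_ge0//; case/andP: r01.
  rewrite ler_wpDl//; first by rewrite mulr_ge0// divr_ge0// ltW.
  apply: ler_pM => //.
    by rewrite (le_trans (ler_normB _ _))// mulr_natl mulr2n lerD// phiB.
  rewrite /K -mul2n exprM lerXn2r// ?nnegrE ?exprn_ge0 ?normc_ge0//.
    by rewrite mulr_ge0//; case/andP: r01.
  have -> : normc (1 + z * v j) ^+ 2 = 4 - normc (z - w j) ^+ 2.
    have -> : normc (z - w j) = normc (1 - z * v j).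
      rewrite -[LHS]mulr1 -(v1 j) -normcM mulrBl normcBC; congr (normc (_ - _)).
      by rewrite mulrC -sqr_normc normr_normc v1 expr1n.
    rewrite normc1D ?zv1// normc1D ?normcN ?zv1// cReN; ring.
  have -> : 4 * r = 4 - del ^+ 2 by rewrite /r; field.
  by rewrite lerB// lerXn2r// nnegrE ?normc_ge0// ltW.
apply: (le_trans (ler_sum _ (fun j _ => step j))).
rewrite big_split /= -mulr_sumr sumK// sumr_const card_ord -[X in _ +
  X]mulr_natl.
rewrite exprMn.
have hN2 : 2 * B * (N.+1%:R * r ^+ N) <= e / 2.
  apply: (@le_trans _ _ (2 * B * (e / (4 * B + 1)))).
    by rewrite ler_wpM2l// mulr_ge0.
  rewrite mulrA ler_pdivrMr ?ltr_wpDl ?mulr_ge0//. nra.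
apply: (@le_trans _ _ (e / 2 * a + a * (e / 2))); last first.
  by rewrite le_eqVlt; apply/orP; left; apply/eqP; field.
rewrite lerD2l; apply: (@le_trans _ _ (4 ^+ N * (2 * B * (N.+1%:R * r ^+ N)))).
  by rewrite le_eqVlt; apply/orP; left; apply/eqP; ring.
apply: ler_pM => //.
by rewrite !mulr_ge0// exprn_ge0//; case/andP: r01.
Qed.

Lemma circle_approx (C : R) (phi : R[i] -> R) (B : R) : 0 < C ->
  (forall z, normc z = C -> `|phi z| <= B) -> circle_ucont C phi ->
  forall e : R, 0 < e ->
  exists Q : {poly R[i]},
    forall z, normc z = C -> `|phi z - complex.Re Q.[z]| <= e.
Proof.
move=> C0 phiB uphi e e0.
have nC u : normc u = 1 -> normc (C%:C * u) = C.
  by move=> u1; rewrite normcM u1 normc_realc gtr0_norm ?mulr1.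
have [| |Q hQ] := @unit_circle_approx (fun u => phi (C%:C * u)) B _ _ e e0.
- by move=> u /nC/phiB.
- move=> e' e'0; have [del del0 hdel] := uphi e' e'0.
  exists (del / C); first by rewrite divr_gt0.
  move=> z w z1 w1 zw; apply: hdel; rewrite ?nC//.
  by rewrite -mulrBr normcM normc_realc gtr0_norm// mulrC -ltr_pdivlMr.
exists (Q \Po ((C%:C)^-1 *: 'X)) => z zC.
have C0' : C%:C != 0 :> R[i] by rewrite (inj_eq (@complexI R) C 0) gt_eqF.
have := hQ ((C%:C)^-1 * z); rewrite horner_comp hornerZ hornerX mulVKf//.
by apply; rewrite normcM normcV zC normc_realc gtr0_norm// mulVf// gt_eqF.
Qed.

End TrigonometricApproximation.

(** * Topology of the closed disc *)

Section ComplexTopology.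
Variable R : realType.
Implicit Types (z w : R[i]) (D : set R[i]) (u : R[i] -> R).

(** The radii of balls in [R[i]] are positive complex numbers; this brings them
    back to [R]. *)
Lemma nbhs_normcP z (P : set R[i]) : nbhs z P <->
  exists2 e : R, 0 < e & forall w, normc (z - w) < e -> P w.
Proof.
split=> [/nbhs_ballP[e /= e0 eP]|[e e0 eP]].
  exists (complex.Re e); first by move: e0; rewrite ltcE => /andP[].
  move=> w zw; apply: eP; rewrite -ball_normE /= normr_normc.
  by move: e0; rewrite !ltcE /= => /andP[/eqP -> _]; rewrite eqxx.
apply/nbhs_ballP; exists e%:C => /=; first by rewrite (ltcR 0).
by move=> w; rewrite -ball_normE /= normr_normc ltcR; exact: eP.
Qed.

Lemma within_continuousP D u : {within D, continuous u} <->
  forall z, D z -> forall e : R, 0 < e -> exists2 del : R, 0 < del &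
    forall w, D w -> normc (z - w) < del -> `|u z - u w| < e.
Proof.
split=> [cu z Dz e e0|cu].
  move/subspace_continuousP : cu => /(_ z Dz) /cvgrPdist_lt /(_ e e0).
  move=> /nbhs_normcP [del del0 h].
  by exists del => // w Dw /h; exact.
apply/subspace_continuousP => z Dz; apply/cvgrPdist_lt => e e0.
have [del del0 h] := cu z Dz e e0.
by apply/nbhs_normcP; exists del => // w zw Dw; exact: h.
Qed.

Lemma continuous_normcP u : continuous u <->
  forall z (e : R), 0 < e -> exists2 del : R, 0 < del &
    forall w, normc (z - w) < del -> `|u z - u w| < e.
Proof.
split=> [cu z e e0|cu z].
  by apply/nbhs_normcP; apply: ((@cvgrPdist_lt _ _ _ (nbhs z) _ u (u z)).1 (cu
    z)).
by apply: (@cvgrPdist_lt _ _ _ (nbhs z) _ u (u z)).2 => e e0; apply/nbhs_normcP;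
  exact: cu.
Qed.

Lemma lipschitz_continuous u :
  (forall z w, `|u z - u w| <= normc (z - w)) -> continuous u.
Proof.
move=> lu; apply/continuous_normcP => z e e0.
by exists e => // w; exact: le_lt_trans.
Qed.

Lemma continuous_Re : continuous (@complex.Re R).
Proof. by apply: lipschitz_continuous => z w; rewrite -cReB normc_le_Re. Qed.

Lemma continuous_Im : continuous (@complex.Im R).
Proof.
apply: lipschitz_continuous => -[a b] [c e].
exact: normc_le_Im ((a +i* b) - (c +i* e)).
Qed.

Lemma continuous_normc : continuous (@normc R).
Proof.
apply: lipschitz_continuous => z w; rewrite ler_norml lerNl opprB.
by rewrite {1}normcBC !normc_sub_le.
Qed.

Lemma closed_discE (C : R) : closed_disc C = [set z | normc z <= C].
Proof. by apply/seteqP; split => z; rewrite /closed_disc /= normr_normc lecR.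
  Qed.

Lemma open_discE (C : R) : open_disc C = [set z | normc z < C].
Proof. by apply/seteqP; split => z; rewrite /open_disc /= normr_normc ltcR. Qed.

Lemma closed_closed_disc (C : R) : closed (closed_disc C).
Proof.
rewrite closed_discE; apply: (closed_comp (f := @normc R) (D := [set x | x <=
  C])).
  by move=> x _; exact: continuous_normc.
exact: closed_le.
Qed.

(** The disc is a closed part of the image of a square of [R * R]. *)
Lemma compact_closed_disc (C : R) : compact (closed_disc C).
Proof.
pose e (p : R * R) : R[i] := p.1 +i* p.2.
have ce : continuous e.
  move=> p; apply/cvgrPdist_lt => eps; rewrite ltcE /= => /andP[/eqP iE r0];
    near=> q.
  suff : normc (e p - e q) < complex.Re eps by rewrite normr_normc ltcE /=
    iE eqxx.
  apply: (le_lt_trans (normc_le_ReIm _)); rewrite (splitr (complex.Re eps)) /=.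
  apply: ltrD; near: q.
    apply: (@cvgrPdist_lt _ _ _ (nbhs p) _ fst p.1).1; last by rewrite divr_gt0.
    exact: cvg_fst.
  apply: (@cvgrPdist_lt _ _ _ (nbhs p) _ snd p.2).1; last by rewrite divr_gt0.
  exact: cvg_snd.
pose B := `[- C, C]%classic `*` `[- C, C]%classic : set (R * R).
have -> : closed_disc C = (e @` B) `&` closed_disc C.
  apply/seteqP; split => [z|z []//]; rewrite closed_discE /= => zC; split=> //.
  exists (complex.Re z, complex.Im z); last by case: z {zC}.
  split; rewrite /= in_itv /= -ler_norml; apply: le_trans zC.
    exact: normc_le_Re.
  exact: normc_le_Im.
apply: compact_closedI; last exact: closed_closed_disc.
apply: continuous_compact; first exact/continuous_subspaceT.
by apply: compact_setX; exact: segment_compact.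
Unshelve. all: by end_near. Qed.

(** Heine's theorem: each point has a neighbourhood on which all small enough
    [del] work, and the disc is compact. *)
Lemma closed_disc_ucont (C : R) u : {within closed_disc C, continuous u} ->
  forall e : R, 0 < e -> exists2 del : R, 0 < del &
  forall z w, normc z <= C -> normc w <= C -> normc (z - w) < del ->
    `|u z - u w| <= e.
Proof.
move=> /within_continuousP; have := @compact_closed_disc C.
rewrite closed_discE => /compact_near_coveringP cD cu e e0.
have [] // := cD _ (0 : R)^'+ (fun del z => normc z <= C ->
  forall w, normc w <= C ->
  normc (z - w) < del -> `|u z - u w| <= e) _ _; last first.
  move=> del /= del0 h; exists (del / 2); first by rewrite divr_gt0.
  move=> z w zC; apply: (h (del / 2)) => //=.
    rewrite sub0r normrN gtr0_norm ?divr_gt0// ltr_pdivrMr//; lra.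
  by rewrite divr_gt0.
move=> z zC; have [|eta eta0 h] := cu z zC (e / 2); first by rewrite divr_gt0.
exists ([set w | normc (z - w) < eta / 2], [set del | del < eta / 2]) => /=.
  split; last by apply: nbhs_right_lt; rewrite divr_gt0.
  by apply/nbhs_normcP; exists (eta / 2); rewrite ?divr_gt0.
move=> [x del] /= [zx de] xC w wC xw.
have hx : `|u z - u x| < e / 2.
  by apply: h => //; rewrite (lt_le_trans zx)// ler_pdivrMr//; lra.
have hw : `|u z - u w| < e / 2.
  apply: h => //; rewrite -(subrK x z) -addrA (le_lt_trans (normc_triangle _
    _))//.
  by rewrite (splitr eta) ltrD// (lt_trans xw).
rewrite ltW// (splitr e) -(subrK (u z) (u x)) -addrA (le_lt_trans (ler_normD _
  _))//.
by rewrite ltrD// distrC.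
Qed.

Lemma closed_disc_bounded (C : R) u : 0 <= C ->
  {within closed_disc C, continuous u} ->
  exists B : R, forall z, normc z <= C -> `|u z| <= B.
Proof.
move=> C0 cu; have D0 : closed_disc C !=set0.
  by exists 0; rewrite closed_discE /mkset normc0.
have cD := @compact_closed_disc C.
have [M _ hM] := compact_EVT_max D0 cD cu.
have [m _ hm] := compact_EVT_min D0 cD cu.
exists (`|u M| + `|u m|) => z zC; have zD : z \in closed_disc C by rewrite inE
  closed_discE.
rewrite ler_norml; apply/andP; split.
  rewrite (le_trans _ (hm z zD))// opprD -[leRHS]add0r lerD// ?oppr_le0//.
  by rewrite lerNl -normrN ler_norm.
by rewrite (le_trans (hM z zD))// ler_wpDr// ler_norm.
Qed.

End ComplexTopology.

(** * Discrete harmonicity and the maximum principle *)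

Section MaximumPrinciple.
Variable R : realType.
Implicit Types (z w : R[i]) (u v : R[i] -> R) (Q : {poly R[i]}).

Definition discrete_laplacian u z (t : R) : R :=
  u (z + t%:C) + u (z - t%:C) + u (z + (0 +i* t)) + u (z - (0 +i* t)) - 4 * u z.

(** A pointwise form of harmonicity that mentions no derivative: it holds for
    harmonic functions, real parts of polynomials and logarithmic potentials
    alike, and together with continuity it suffices for the maximum principle. *)
Definition discretely_harmonic u z : Prop := forall eta : R, 0 < eta ->
  exists2 tau : R, 0 < tau & forall t : R, 0 < t < tau ->
    `|discrete_laplacian u z t| <= eta * t ^+ 2.

Lemma discretely_harmonicN u z :
  discretely_harmonic u z -> discretely_harmonic (fun w => - u w) z.
Proof.
move=> hu eta eta0; have [tau tau0 h] := hu eta eta0; exists tau => // t /h.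
rewrite -normrN; congr (`|_| <= _); rewrite /discrete_laplacian; ring.
Qed.

Lemma discretely_harmonicB u v z : discretely_harmonic u z ->
  discretely_harmonic v z -> discretely_harmonic (fun w => u w - v w) z.
Proof.
move=> hu hv eta eta0.
have [|tu tu0 hu'] := hu (eta / 2); first by rewrite divr_gt0.
have [|tv tv0 hv'] := hv (eta / 2); first by rewrite divr_gt0.
exists (Num.min tu tv) => [|t]; first by rewrite lt_min tu0.
rewrite lt_min => /and3P[t0 ttu ttv].
have -> : discrete_laplacian (fun w => u w - v w) z t =
  discrete_laplacian u z t - discrete_laplacian v z t.
  by rewrite /discrete_laplacian; ring.
rewrite (le_trans (ler_normB _ _))// (splitr eta) mulrDl lerD//.
  by rewrite hu'// t0.
by rewrite hv'// t0.
Qed.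

(** At an interior maximum the discrete Laplacian is nonpositive; adding a small
    multiple of [|z|^2], whose discrete Laplacian is [4 t^2], makes this
    impossible. *)
Lemma maximum_principle (C : R) u (e : R) :
  {within closed_disc C, continuous u} ->
  (forall z, normc z < C -> discretely_harmonic u z) ->
  (forall z, normc z = C -> u z <= e) ->
  forall z, normc z <= C -> u z <= e.
Proof.
move=> cu hu bu p0 p0C; rewrite leNgt; apply/negP => up0.
have C0 : 0 <= C := le_trans (normc_ge0 _) p0C.
pose kap := u p0 - e; have kap0 : 0 < kap by rewrite subr_gt0.
(* [g] is so small that [g |z|^2] stays below the excess [kap] on the disc; the
   [+ 1] covers [C = 0]. *)
pose g := kap / (2 * (C ^+ 2 + 1)).
have C21 : 0 < C ^+ 2 + 1 by rewrite ltr_wpDl// sqr_ge0.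
have g0 : 0 < g by rewrite divr_gt0// mulr_gt0.
have gC : g * C ^+ 2 < kap.
  rewrite /g mulrAC ltr_pdivrMr ?mulr_gt0// ltr_pM2l//; nra.
pose w z := u z + g * normc z ^+ 2.
have cw : {within closed_disc C, continuous w}.
  move=> x; apply: (@continuousD _ R^o (subspace (closed_disc C)) u (fun z =>
    g * normc z ^+ 2)).
    exact: cu.
  apply: continuous_subspaceT => y.
  apply: (@continuous_comp _ _ _ (@normc R) (fun x => g * x ^+ 2)).
    exact: continuous_normc.
  by apply: cvgM; [exact: cvg_cst|exact: exprn_continuous].
have D0 : closed_disc C !=set0 by exists p0; rewrite closed_discE.
have [p] := compact_EVT_max D0 (@compact_closed_disc R C) cw.
rewrite inE closed_discE /= => pC wp.
have wp0 : w p0 <= w p by apply: wp; rewrite inE.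
have w_ge : e + kap <= w p.
  by apply: le_trans wp0; rewrite /w /kap addrC subrK lerDl mulr_ge0 ?sqr_ge0//
    ltW.
have pC' : normc p < C.
  rewrite lt_neqAle pC andbT; apply/eqP => pE.
  have := bu p pE; move: w_ge; rewrite /w pE; lra.
have [tau tau0 htau] := hu p pC' g g0.
pose t := Num.min tau (C - normc p) / 2.
have m0 : 0 < Num.min tau (C - normc p) by rewrite lt_min tau0 subr_gt0.
have t0 : 0 < t by rewrite divr_gt0.
have ttau : t < tau.
  by rewrite ltr_pdivrMr// (le_lt_trans (_ : _ <= tau))// ?ge_min ?lexx//
    ltr_pMr// ltr1n.
have tC : t < C - normc p.
  rewrite ltr_pdivrMr// (le_lt_trans (_ : _ <= C - normc p))//
    ?ge_min ?lexx ?orbT//.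
  by rewrite ltr_pMr ?subr_gt0// ltr1n.
have nearp h : normc h = t -> w (p + h) <= w p.
  move=> ht; apply: wp; rewrite inE /=.
  rewrite (le_trans (normc_triangle _ _))// ht; lra.
have n1 : normc t%:C = t by rewrite normc_realc gtr0_norm.
have n2 : normc (0 +i* t) = t.
  by rewrite /= expr0n /= add0r sqrtr_sqr gtr0_norm.
have := nearp _ n1; have := nearp _ n2.
have := nearp (- t%:C); rewrite normcN => /(_ n1).
have := nearp (- (0 +i* t)); rewrite normcN => /(_ n2).
have := htau t; rewrite t0 ttau => /(_ isT); rewrite ler_norml => /andP[+ _].
rewrite /w /discrete_laplacian !sqr_normcE.
case: (p) => a b /=; rewrite !(addr0, add0r, oppr0).
have t20 : 0 < g * t ^+ 2 by rewrite mulr_gt0// exprn_gt0.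
move=> h1 h2 h3 h4 h5; move: t20 h1 h2 h3 h4 h5.
rewrite !(sqrrD, sqrrB, mulrDr, mulrBr); lra.
Qed.

(** Taylor expansion to second order: the increments [t, -t, it, -it] have
    vanishing sum and vanishing sum of squares. *)
Lemma discretely_harmonic_poly Q z :
  discretely_harmonic (fun w => complex.Re Q.[w]) z.
Proof.
pose T := Q \Po ('X + z%:P).
have TE h : Q.[z + h] = T.[h] := horner_shift Q z h.
have dropE := @poly_drop1E R.
pose S := drop_poly 1 (drop_poly 1 (drop_poly 1 T)).
have [a [b [c TS]]] : exists a b c, forall h, T.[h] = a + b * h + c * h ^+ 2 +
  h ^+ 3 * S.[h].
  exists T`_0, (drop_poly 1 T)`_0, (drop_poly 1 (drop_poly 1 T))`_0 => h.
  rewrite {1}(dropE T) {1}(dropE (drop_poly 1 T)) {1}(dropE (drop_poly 1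
    (drop_poly 1 T))).
  by rewrite !(hornerD, hornerM, hornerX, hornerC) -/S; ring.
have [M M0 SM] := horner_bounded S.
move=> eta eta0; exists (Num.min 1 (eta / (4 * M + 1))) => [|t].
  by rewrite lt_min ltr01 divr_gt0// ltr_wpDl// mulr_ge0.
rewrite lt_min => /and3P[t0 t1 tM].
pose i1 : R[i] := 0 +i* 1.
have it : 0 +i* t = i1 * t%:C :> R[i] by rewrite /i1; simpc.
have n1 : normc t%:C = t by rewrite normc_realc gtr0_norm.
have n2 : normc (i1 * t%:C) = t.
  by rewrite normcM n1 /= expr0n /= add0r expr1n sqrtr1 mul1r.
have hS h : normc h = t -> normc (h ^+ 3 * S.[h]) <= t ^+ 3 * M.
  by move=> ht; rewrite normcM normcX ht ler_wpM2l ?exprn_ge0 ?SM ?ht// ltW.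
have -> : discrete_laplacian (fun w => complex.Re Q.[w]) z t = complex.Re (
    t%:C ^+ 3 * S.[t%:C] + (- t%:C) ^+ 3 * S.[- t%:C] +
    (i1 * t%:C) ^+ 3 * S.[i1 * t%:C] + (- (i1 * t%:C)) ^+
      3 * S.[- (i1 * t%:C)]).
  have Q0 : Q.[z] = T.[0] by rewrite -TE addr0.
  rewrite /discrete_laplacian it Q0 !TE !TS.
  have -> (x : R[i]) : 4 * complex.Re x = complex.Re (4 * x).
    by rewrite !mulr_natl -[4%N]/(2 + 2)%N !mulrnDr !mulr2n !cReD.
  rewrite -!cReD -cReB; congr complex.Re.
  have i2 : i1 ^+ 2 = -1 by rewrite /i1 sqr_i.
  rewrite expr0n /= mulr0 !addr0 expr0n /= mul0r !sqrrN !exprMn i2 mulN1r.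
  ring.
apply: (le_trans (normc_le_Re _)); apply: (@le_trans _ _ (t ^+ 3 * M * 4)).
  have := hS _ n1; have := hS _ n2; have := hS (- t%:C);
    have := hS (- (i1 * t%:C)).
  rewrite !normcN => /(_ n2) h1 /(_ n1) h2 h3 h4.
  rewrite (_ : _ * 4 = t ^+ 3 * M + t ^+ 3 * M + t ^+ 3 * M + t ^+ 3 * M);
    last by ring.
  by do 3 (rewrite (le_trans (normc_triangle _ _))// lerD//).
have : t * (4 * M + 1) < eta by rewrite -ltr_pdivlMr// ltr_wpDl// mulr_ge0.
move=> h; rewrite (_ : _ * 4 = t * (4 * M) * t ^+ 2); last by ring.
rewrite ler_wpM2r ?sqr_ge0//; nra.
Qed.

Lemma normr_ln1B_le (s y : R) : 0 <= s <= 2^-1 -> 1 - s <= y <= 1 + s ->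
  `|ln y| <= 2 * s.
Proof.
move=> /andP[s0 s1] /andP[y1 y2].
have s2 : s <= 1 / 2 by rewrite div1r.
have y0 : 0 < y by lra.
have ub : ln y <= y - 1 by rewrite -{1}(subrK 1 y) addrC le_ln1Dx//; lra.
have lb : - ln y <= y^-1 - 1.
  rewrite -lnV// -{1}(subrK 1 y^-1) addrC le_ln1Dx//.
  by rewrite ltrBrDr addNr invr_gt0.
have : y^-1 - 1 <= 2 * s.
  rewrite lerBlDr -[y^-1]mul1r ler_pdivrMr//.
  apply: (@le_trans _ _ ((2 * s + 1) * (1 - s))); first by nra.
  by rewrite ler_wpM2l// addr_ge0// mulr_ge0.
move=> yy; rewrite ler_norml; apply/andP; split; lra.
Qed.

(** The four increments [h] satisfy [\prod_h (w - h) = w^4 - t^4], so the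
    discrete Laplacian of the potential is [ln |1 - (t / w)^4|]. *)
Lemma discretely_harmonic_ln (xi z : R[i]) : z != xi ->
  discretely_harmonic (fun w => ln (normc (xi - w))) z.
Proof.
move=> zxi; pose y := xi - z; pose m := normc y.
have m0 : 0 < m by rewrite lt_neqAle normc_ge0 eq_sym normc_eq0 subr_eq0 eq_sym
  zxi.
move=> eta eta0.
(* [t < m / 2] keeps [(t / m)^4] below [1 / 2], where [ln] is controlled; the last
   bound makes [2 (t / m)^4] at most [eta t^2]. *)
exists (Num.min 1 (Num.min (m / 2) (eta * m ^+ 4 / 2))) => [|t].
  by rewrite !lt_min ltr01 !divr_gt0// mulr_gt0// exprn_gt0.
rewrite !lt_min => /and4P[t0 t1 tm te].
pose i1 : R[i] := 0 +i* 1.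
have it : 0 +i* t = i1 * t%:C :> R[i] by rewrite /i1; simpc.
have n1 : normc t%:C = t by rewrite normc_realc gtr0_norm.
have n2 : normc (i1 * t%:C) = t.
  by rewrite normcM n1 /= expr0n /= add0r expr1n sqrtr1 mul1r.
have tm' : t < m by lra.
have pos h : normc h = t -> 0 < normc (y - h).
  by move=> ht; rewrite (lt_le_trans _ (normc_sub_le _ _))// ht subr_gt0.
pose s := t ^+ 4 / m ^+ 4.
have -> : discrete_laplacian (fun w => ln (normc (xi - w))) z t =
    ln (normc (1 - (t%:C / y) ^+ 4)).
  have p1 := pos _ n1; have p2 := pos _ n2.
  have p3 := pos (- t%:C); have p4 := pos (- (i1 * t%:C)).
  rewrite normcN n1 in p3; rewrite normcN n2 in p4.
  have {}p3 := p3 erefl; have {}p4 := p4 erefl.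
  rewrite /discrete_laplacian it !opprD !addrA -/y !opprK.
  rewrite opprK in p3; rewrite opprK in p4.
  have y40 : 0 < m ^+ 4 by rewrite exprn_gt0.
  rewrite -!lnM ?posrE ?mulr_gt0// -[X in _ - X * _]/(4%:R) mulr_natl -lnXn//
    -lnV ?posrE//.
  rewrite -lnM ?posrE ?mulr_gt0 ?invr_gt0//; congr ln.
  rewrite -/m -normcX -!normcM -normcV -normcM; congr normc.
  have i2 : i1 ^+ 2 = -1 by rewrite /i1 sqr_i.
  have y0 : y != 0 by rewrite subr_eq0 eq_sym.
  have y4 : y ^+ 4 != 0 by rewrite expf_neq0.
  rewrite expr_div_n -[1 in RHS](divff y4) -mulrBl; congr (_ / _).
  rewrite [LHS](_ : _ = (y ^+ 2 - t%:C ^+ 2) * (y ^+ 2 - i1 ^+ 2 * t%:C ^+ 2));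
    last by ring.
  by rewrite i2; ring.
have sE : normc ((t%:C / y) ^+ 4) = s.
  by rewrite normcX normcM normcV n1 expr_div_n.
have s0 : 0 <= s by rewrite divr_ge0 ?exprn_ge0// ltW.
apply: (@le_trans _ _ (2 * s)).
  apply: normr_ln1B_le.
    rewrite s0 /s -expr_div_n (@le_trans _ _ ((2^-1) ^+ 4))//.
      by rewrite lerXn2r// ?nnegrE ?divr_ge0 ?invr_ge0 ?ltW// ltr_pdivrMr//
        mulrC.
    by rewrite exprS ler_piMr ?exprn_ile1 ?invr_ge0// invf_le1// ler1n.
  have := normc_sub_le 1 ((t%:C / y) ^+ 4); rewrite normc1 sE => ->.
  by have := normc_triangle 1 (- (t%:C / y) ^+ 4); rewrite normcN normc1 sE.
rewrite (_ : 2 * s = (2 * t ^+ 2 / m ^+ 4) * t ^+ 2); last by rewrite /s; field;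
  rewrite gt_eqF.
rewrite ler_wpM2r ?sqr_ge0// ler_pdivrMr ?exprn_gt0//.
have : t * t <= t by rewrite ler_piMr// ltW.
rewrite -expr2; lra.
Qed.
End MaximumPrinciple.

(** * Approximation of harmonic functions on the disc *)

Section HarmonicApproximation.
Variable R : realType.

Lemma is_derive_line (u : R * R -> R) (p v : R * R) (s : R) :
  derivable u (p + s *: v) v ->
  is_derive s (1 : R) (fun s => u (p + s *: v)) ('D_v u (p + s *: v)).
Proof.
move=> du; pose phi s := u (p + s *: v).
have E : (fun h : R => h^-1 *: ((phi \o shift s) (h *: (1 : R)) - phi s)) =
    (fun h => h^-1 *: ((u \o shift (p + s *: v)) (h *: v) - u (p + s *: v))).
  apply/funext => h; congr (_ *: (u _ - _)).
  by rewrite /= [h *: 1]mulr1 scalerDl addrCA.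
by split; rewrite /derivable /derive -/phi E.
Qed.

(** Apply the mean value theorem to [phi t + phi (- t) - c t^2]: its derivative
    [dphi t - dphi (- t) - 2 c t] is [o(t)], because [dphi] is differentiable at
    [0]. *)
Lemma second_difference (phi dphi : R -> R) (c r : R) : 0 < r ->
  (forall s, `|s| < r -> is_derive s (1 : R) phi (dphi s)) ->
  is_derive (0 : R) (1 : R) dphi c ->
  forall eta : R, 0 < eta -> exists2 tau : R, 0 < tau & forall t, 0 < t < tau ->
    `|phi t + phi (- t) - 2 * phi 0 - c * t ^+ 2| <= eta * t ^+ 2.
Proof.
move=> r0 hphi [ddphi dE] eta eta0.
have eta2 : 0 < eta / 2 by rewrite divr_gt0.
have : (fun h : R => h^-1 *: ((dphi \o shift 0) (h *: (1 :
  R)) - dphi 0)) @ 0^' --> c.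
  by rewrite -dE.
move/cvgrPdist_le => /(_ _ eta2) [tau' /= tau'0 htau'].
pose tau := Num.min r tau'.
have hd s : `|s| < tau -> `|dphi s - dphi 0 - c * s| <= eta / 2 * `|s|.
  rewrite lt_min => /andP[_ st]; have [->|s0] := eqVneq s 0.
    by rewrite subrr mulr0 subr0 normr0 mulr0.
  have := htau' s; rewrite /= sub0r normrN => /(_ st s0).
  rewrite [s *: 1]mulr1 addr0 => h.
  rewrite (_ : dphi s - dphi 0 - c * s = - (s * (c - s^-1 *:
    (dphi s - dphi 0)))).
    by rewrite normrN normrM mulrC ler_wpM2r.
  by rewrite mulrBr [_ *: _]mulrC mulrCA divff// mulr1 opprB mulrC.
exists tau => [|t /andP[t0 ttau]]; first by rewrite lt_min r0.
pose g s := phi s + phi (- s) - c * s ^+ 2.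
have dg s : `|s| < tau -> is_derive s (1 : R) g (dphi s - dphi (- s) - 2 * c *
  s).
  rewrite lt_min => /andP[sr _].
  have d1 := hphi s sr; have d2 : is_derive (- s) (1 : R) phi (dphi (- s)).
    by apply: hphi; rewrite normrN.
  have d3 : is_derive s (1 : R) (phi \o -%R) (dphi (- s) * -1).
    exact: is_derive1_comp.
  apply: (@is_derive_eq _ _ _ (phi + (phi \o -%R) - c *: (@GRing.exp R ^~ 2))).
  rewrite -[c *: _]/(c * (s * 1 + s * 1)); ring.
have st s : s \in `[0, t] -> `|s| < tau.
  by rewrite in_itv /= => /andP[s0 st]; rewrite ger0_norm// (le_lt_trans st).
have [|||xi xit gE] := @MVT_segment R g (fun s =>
  dphi s - dphi (- s) - 2 * c * s) 0 t.
- exact: ltW.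
- by move=> s s0t; apply: dg; apply: st; exact: subset_itv_oo_cc.
- apply: derivable_within_continuous => s /st /dg ds; exact: ex_derive.
have := hd _ (st _ xit); have := hd (- xi); rewrite normrN =>
  /(_ (st _ xit)) h1 h2.
move: xit; rewrite in_itv /= => /andP[xi0 xit].
rewrite (_ : _ - _ - _ = g t - g 0); last first.
  by rewrite /g oppr0 expr0n /= mulr0 subr0; ring.
rewrite gE subr0 normrM (gtr0_norm t0) expr2 mulrA ler_wpM2r ?(ltW t0)//.
rewrite (_ : _ - _ - _ = (dphi xi - dphi 0 - c * xi) - (dphi (- xi) - dphi 0 - c
  * - xi)); last by ring.
rewrite (le_trans (ler_normB _ _))// (le_trans (lerD h2 h1))//.
by rewrite -mulrDl -splitr (ger0_norm xi0) ler_wpM2l// ltW.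
Qed.

Lemma directional_second_difference (u : R * R -> R) (p v : R * R) (r : R) :
  0 < r -> (forall s, `|s| < r -> derivable u (p + s *: v) v) ->
  derivable ('D_v u) p v ->
  forall eta : R, 0 < eta -> exists2 tau : R, 0 < tau & forall t, 0 < t < tau ->
    `|u (p + t *: v) + u (p + (- t) *: v) - 2 * u p - 'D_v ('D_v u) p * t ^+ 2|
      <= eta * t ^+ 2.
Proof.
move=> r0 d1 d2 eta eta0.
have h1 s : `|s| < r -> is_derive s (1 : R) (fun s => u (p + s *:
  v)) ('D_v u (p + s *: v)).
  by move=> sr; apply: is_derive_line; exact: d1.
have h2 : is_derive (0 : R) (1 : R) (fun s => 'D_v u (p + s *:
  v)) ('D_v ('D_v u) p).
  have p0 : p + (0 : R) *: v = p by rewrite scale0r addr0.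
  have := @is_derive_line ('D_v u) p v 0; rewrite p0 => /(_ d2); apply.
have := second_difference r0 h1 h2 eta0.
by rewrite /= scale0r addr0.
Qed.

(** The second differences along the two axes tend to the second partial
    derivatives, whose sum vanishes. *)
Lemma harmonic2_discrete (C : R) (u : R[i] -> R) :
  harmonic2 [set p : R * R | open_disc C (p.1 +i* p.2)]
    (fun p => u (p.1 +i* p.2)) ->
  forall z, normc z < C -> discretely_harmonic u z.
Proof.
rewrite open_discE; have [u2 u2E] : exists u2, u2 = fun p :
  R * R => u (p.1 +i* p.2).
  by eexists.
rewrite -u2E => -[h2 hL] -[x y] zC eta eta0.
have r0 : 0 < C - normc (x +i* y) by rewrite subr_gt0.
have eta2 : 0 < eta / 2 by rewrite divr_gt0.
have near_in (a b s : R) : a ^+ 2 + b ^+ 2 = 1 -> `|s| < C - normc (x +i* y) ->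
    normc ((x + s * a) +i* (y + s * b)) < C.
  move=> ab sr; rewrite -[_ +i* _]/((x +i* y) + ((s * a) +i* (s * b))).
  rewrite (le_lt_trans (normc_triangle _ _))// -ltrBrDl (le_lt_trans _ sr)//.
  by rewrite /= !exprMn -mulrDr ab mulr1 sqrtr_sqr.
have key (a b : R) : a ^+ 2 + b ^+ 2 = 1 -> (a, b) \in [:: (1, 0); (0, 1)] ->
    exists2 tau : R, 0 < tau & forall t, 0 < t < tau ->
    `|u2 (x + t * a, y + t * b) + u2 (x - t * a, y - t * b) - 2 * u2 (x, y) -
       'D_(a, b) ('D_(a, b) u2) (x, y) * t ^+ 2| <= eta / 2 * t ^+ 2.
  move=> ab vin.
  have d1 s : `|s| < C - normc (x +i* y) -> derivable u2 ((x, y) + s *: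
    (a, b)) (a, b).
    move=> /(near_in a b s ab) sU.
    by case: (h2 ((x, y) + s *: (a, b)) (a, b) (a, b) sU vin vin).
  have d2 : derivable ('D_(a, b) u2) (x, y) (a, b).
    by case: (h2 (x, y) (a, b) (a, b) zC vin vin).
  have [tau tau0 htau] := directional_second_difference r0 d1 d2 eta2.
  exists tau => // t /htau.
  rewrite -[(x, y) + t *: (a, b)]/(x + t * a, y + t * b).
  by rewrite -[(x, y) + (- t) *: (a, b)]/(x + (- t) * a, y + (- t) * b) !mulNr.
have [||tx tx0 hx] := key 1 0; rewrite ?inE ?eqxx ?expr1n ?expr0n ?addr0//.
have [||ty ty0 hy] := key 0 1; rewrite ?inE ?eqxx ?orbT ?expr1n ?expr0n
  ?add0r//.
exists (Num.min tx ty) => [|t]; first by rewrite lt_min tx0.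
rewrite lt_min => /and3P[t0 ttx tty].
have hL' := hL (x, y) zC.
have {}hx := hx t; rewrite t0 ttx !mulr1 !mulr0 !addr0 !subr0 in hx.
have {}hy := hy t; rewrite t0 tty !mulr1 !mulr0 !addr0 !subr0 in hy.
rewrite (_ : discrete_laplacian u (x +i* y) t =
  (u2 (x + t, y) + u2 (x - t, y) - 2 * u2 (x, y) - 'D_(1, 0) ('D_(1, 0) u2) (x,
    y) * t ^+ 2) +
  (u2 (x, y + t) + u2 (x, y - t) - 2 * u2 (x, y) - 'D_(0, 1) ('D_(0, 1) u2) (x,
    y) * t ^+ 2)).
  apply: (le_trans (ler_normD _ _)).
  rewrite [leRHS](_ : _ = eta / 2 * t ^+ 2 + eta / 2 * t ^+ 2); last first.
    by rewrite -mulrDl -splitr.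
  by apply: lerD; [exact: hx|exact: hy].
rewrite (_ : 'D_(1, 0) ('D_(1, 0) u2) (x, y) = - 'D_(0, 1) ('D_(0, 1) u2) (x,
  y)); last first.
  by apply/eqP; rewrite -addr_eq0; apply/eqP.
rewrite /discrete_laplacian u2E /=.
rewrite -[(x +i* y) + t%:C]/((x + t) +i* (y + 0)) -[(x +i* y) - t%:C]/((x - t)
  +i* (y - 0)).
rewrite -[(x +i* y) + (0 +i* t)]/((x + 0) +i* (y +
  t)) -[(x +i* y) - (0 +i* t)]/((x - 0) +i* (y - t)).
rewrite !addr0 !subr0; ring.
Qed.

Lemma continuous_Re_horner (Q : {poly R[i]}) :
  continuous (fun w : R[i] => complex.Re Q.[w]).
Proof.
apply/continuous_normcP => z e e0.
pose T := Q \Po ('X + z%:P); have [M M0 hM] := horner_bounded (drop_poly 1 T).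
have TE h : T.[h] = (drop_poly 1 T).[h] * h + T`_0.
  by rewrite {1}(poly_drop1E T) hornerMXaddC.
have M1 : 0 < M + 1 by rewrite ltr_wpDl.
exists (Num.min 1 (e / (M + 1))) => [|w]; first by rewrite lt_min ltr01
  divr_gt0.
rewrite lt_min => /andP[zw1 zwe]; rewrite -cReB (le_lt_trans (normc_le_Re _))//.
have -> : Q.[z] - Q.[w] = (z - w) * (drop_poly 1 T).[w - z].
  have -> : Q.[z] = T.[0] by rewrite -horner_shift addr0.
  have -> : Q.[w] = T.[w - z] by rewrite -horner_shift addrC subrK.
  by rewrite !TE mulr0; ring.
rewrite normcM (@le_lt_trans _ _ (normc (z - w) * M))//.
  by rewrite ler_wpM2l ?normc_ge0// hM// normcBC ltW.
move: zwe; rewrite ltr_pdivlMr// => zwe; have := normc_ge0 (z - w); nra.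
Qed.

Lemma continuous_circle_approx (C : R) (u : R[i] -> R) : 0 < C ->
  {within closed_disc C, continuous u} ->
  forall e : R, 0 < e -> exists Q : {poly R[i]},
    forall z, normc z = C -> `|u z - complex.Re Q.[z]| <= e.
Proof.
move=> C0 cu e e0; have [B uB] := closed_disc_bounded (ltW C0) cu.
apply: (circle_approx C0) e0 => [z zC|e1 e10]; first by apply: uB; rewrite zC.
have [del del0 h] := closed_disc_ucont cu e10.
by exists del => // z w zC wC; apply: h; rewrite ?zC ?wC.
Qed.

(** Approximate [u] on the circle by the real part of a polynomial; the maximum
    principle carries the estimate to the whole disc. *)
Lemma harmonic_poly_approx (C : R) (u : R[i] -> R) : 0 <= C ->
  {within closed_disc C, continuous u} ->
  (forall z, normc z < C -> discretely_harmonic u z) ->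
  forall e : R, 0 < e -> exists Q : {poly R[i]},
    forall z, normc z <= C -> `|u z - complex.Re Q.[z]| <= e.
Proof.
move=> C0 cu hu e e0; have [C00|Cn0] := eqVneq C 0.
  exists (u 0)%:C%:P => z; rewrite C00 => z0; have -> : z = 0.
    by apply/eqP; rewrite -normc_eq0 eq_le z0 normc_ge0.
  by rewrite hornerC /= subrr normr0 ltW.
have Cp : 0 < C by rewrite lt_neqAle eq_sym Cn0.
have [Q hQ] := continuous_circle_approx Cp cu e0.
exists Q => z zC.
have cQ : {within closed_disc C, continuous (fun w => complex.Re Q.[w])}.
  by apply: continuous_subspaceT; exact: continuous_Re_horner.
have cP : {within closed_disc C, continuous (fun w =>
  (u w - complex.Re Q.[w]))}.
  move=> x; apply: (@continuousB _ R^o (subspace (closed_disc C)) u (fun w =>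
    complex.Re Q.[w])).
    exact: cu.
  exact: cQ.
have cN : {within closed_disc C, continuous (fun w =>
  - (u w - complex.Re Q.[w]))}.
  move=> x; apply: (@continuousN _ R^o (subspace (closed_disc C)) (fun w =>
    u w - complex.Re Q.[w])).
  exact: cP.
have hP w : normc w < C -> discretely_harmonic (fun w =>
  u w - complex.Re Q.[w]) w.
  by move=> wC; apply: discretely_harmonicB; [exact: hu|exact:
    discretely_harmonic_poly].
rewrite ler_norml lerNl; apply/andP; split.
  apply: (maximum_principle cN) zC => w wC; first exact/discretely_harmonicN/hP.
  by have := hQ w wC; rewrite ler_norml lerNl => /andP[].
apply: (maximum_principle cP) zC => w wC; first exact/hP.
by have := hQ w wC; rewrite ler_norml => /andP[].
Qed.

End HarmonicApproximation.

(** * Averages over finite sequences and uniform measures *)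

Lemma cvgn_sum (K : numFieldType) (V : normedModType K) (I : Type) (r : seq I)
    (P : pred I) (F : I -> nat -> V) (l : I -> V) :
  (forall i, P i -> F i n @[n --> \oo] --> l i) ->
  \sum_(i <- r | P i) F i n @[n --> \oo] --> \sum_(i <- r | P i) l i.
Proof.
move=> Fl; elim: r => [|i r ih].
  by under eq_fun do rewrite big_nil; rewrite big_nil; exact: cvg_cst.
under eq_fun do rewrite big_cons; rewrite big_cons.
by case: ifPn => // Pi; apply: cvgD => //; exact: Fl.
Qed.

Lemma cvgn_sum_nat (K : numFieldType) (V : normedModType K) (a b : nat)
    (F : nat -> nat -> V) (l : nat -> V) :
  (forall i, (a <= i < b)%N -> F i n @[n --> \oo] --> l i) ->
  \sum_(a <= i < b) F i n @[n --> \oo] --> \sum_(a <= i < b) l i.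
Proof.
move=> Fl; rewrite big_nat.
rewrite (_ : (fun n => _) = fun n => \sum_(a <= i < b | (a <= i < b)%N) F i n).
  exact: cvgn_sum.
by apply/funext => n; rewrite big_nat.
Qed.

Section Averages.
Variable R : realType.
Implicit Types (s : seq R[i]) (u v : R[i] -> R) (Q : {poly R[i]}).

Definition avg s u : R := (\sum_(z <- s) u z) / (size s)%:R.

Lemma avg_cst s (a : R) : (0 < size s)%N -> avg s (fun=> a) = a.
Proof.
move=> s0; rewrite /avg big_const_seq count_predT iter_addr_0 -[a *+
  _]mulr_natr mulfK//.
by rewrite pnatr_eq0 -lt0n.
Qed.

Lemma eq_avg s u v : {in s, u =1 v} -> avg s u = avg s v.
Proof. by move=> uv; rewrite /avg; congr (_ / _); exact: eq_big_seq. Qed.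

Lemma avgD s u v : avg s (fun z => u z + v z) = avg s u + avg s v.
Proof. by rewrite /avg big_split /= mulrDl. Qed.

Lemma avgZ s (a : R) u : avg s (fun z => a * u z) = a * avg s u.
Proof. by rewrite /avg -mulr_sumr mulrA. Qed.

Lemma avg_sum s (I : Type) (r : seq I) (F : I -> R[i] -> R) :
  avg s (fun z => \sum_(i <- r) F i z) = \sum_(i <- r) avg s (F i).
Proof. by rewrite /avg exchange_big /= mulr_suml. Qed.

Lemma le_avg s u v : {in s, forall z, u z <= v z} -> avg s u <= avg s v.
Proof.
move=> uv; rewrite /avg ler_wpM2r ?invr_ge0//.
by rewrite big_seq [leRHS]big_seq ler_sum.
Qed.

Lemma avg_dist s u v (e : R) : (0 < size s)%N ->
  {in s, forall z, `|u z - v z| <= e} -> `|avg s u - avg s v| <= e.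
Proof.
move=> s0 uv; rewrite ler_distl; apply/andP; split.
  rewrite -[e](avg_cst _ s0) -mulN1r -avgZ -avgD; apply: le_avg => z /uv.
  by rewrite ler_distl mulN1r => /andP[].
rewrite -[e](avg_cst _ s0) -avgD; apply: le_avg => z /uv.
by rewrite ler_distl => /andP[].
Qed.

Lemma cvgn_approx (a : nat -> R) :
  (forall e : R, 0 < e -> exists2 b : nat -> R, cvgn b & forall n, `|a n - b n|
    <= e) ->
  cvgn a.
Proof.
move=> h; apply/cauchy_cvgP/cauchy_exP => e e0.
have [|b /cvg_ex [l bl] ab] := h (e / 2); first by rewrite divr_gt0.
exists l; have e2 : 0 < e / 2 by rewrite divr_gt0.
move/cvgrPdist_lt : bl => /(_ _ e2) bl.
suff : \forall n \near \oo, ball l e (a n) by [].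
near=> n.
rewrite -ball_normE /= (splitr e) -(subrK (b n) l) -addrA.
rewrite (le_lt_trans (ler_normD _ _))// ltr_leD//; last by rewrite distrC.
by near: n.
Unshelve. all: by end_near. Qed.

Variable S : nat -> seq R[i].
Hypothesis S_gt0 : forall n, (0 < size (S n))%N.
Hypothesis S_Re : forall k, cvgn (fun n => avg (S n) (fun z => complex.Re (z ^+
  k))).
Hypothesis S_Im : forall k, cvgn (fun n => avg (S n) (fun z => complex.Im (z ^+
  k))).

Lemma avg_poly_cvg Q : cvgn (fun n => avg (S n) (fun z => complex.Re Q.[z])).
Proof.
rewrite (_ : (fun n => _) = fun n => \sum_(k < size Q)
    (complex.Re Q`_k * avg (S n) (fun z => complex.Re (z ^+ k)) -
     complex.Im Q`_k * avg (S n) (fun z => complex.Im (z ^+ k)))); last first.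
  apply/funext => n.
  transitivity (avg (S n) (fun z => \sum_(k < size Q)
    (complex.Re Q`_k * complex.Re (z ^+ k) + - complex.Im Q`_k * complex.Im (z
      ^+ k)))).
    apply: eq_avg => z _; rewrite horner_coef cRe_sum; apply: eq_bigr => k _.
    by rewrite cReM mulNr.
  by rewrite avg_sum; apply: eq_bigr => k _; rewrite avgD !avgZ mulNr.
apply/cvg_ex; eexists; apply: cvgn_sum => k _.
apply: cvgB; apply: cvgMl_tmp; [exact: S_Re|exact: S_Im].
Qed.

(** Averaging contracts the uniform distance, so convergence passes from the real
    parts of polynomials, where it is convergence of moments, to their uniform
    limits. *)
Lemma avg_approx_cvg u (D : set R[i]) : (forall n, {in S n, forall z, D z}) ->
  (forall e : R, 0 < e -> exists Q : {poly R[i]},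
    forall z, D z -> `|u z - complex.Re Q.[z]| <= e) ->
  cvgn (fun n => avg (S n) u).
Proof.
move=> SD uQ; apply: cvgn_approx => e /uQ [Q hQ].
exists (fun n => avg (S n) (fun z => complex.Re Q.[z])); first exact:
  avg_poly_cvg.
by move=> n; apply: avg_dist => // z /SD; exact: hQ.
Qed.

End Averages.

Section UniformMeasure.
Variable R : realType.
Implicit Types (s : seq R[i]) (u : R[i] -> R).

(** The preimage of an open set is relatively open, hence the trace on [D] of a
    generator of the sigma-algebra. *)
Lemma within_continuous_measurable (D : set (borelC R)) u :
  {within D, continuous u} -> measurable_fun D (u : borelC R -> R).
Proof.
move=> cu mD; move: (mD); apply: (measurability _ (RGenOpens.measurableE R)).
move=> _ [_ [a [b ->] <-]].
move/continuousP : cu => /(_ _ (@interval_open R (BRight a) (BLeft b) isT isT)).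
move/open_subspaceP => [V oV VE]; rewrite setIC -VE; apply: measurableI => //.
exact: sub_sigma_algebra.
Qed.

Local Open Scope ereal_scope.

Lemma ge0_integral_uniform s (D : set (borelC R)) (g : borelC R -> \bar R) :
  measurable D -> measurable_fun D g -> (forall z, D z -> 0 <= g z) ->
  {in s, forall z, D z} ->
  \int[uniform_measure s]_(z in D) g z =
  ((size s)%:R^-1)%:E * \sum_(z <- s) g z.
Proof.
move=> mD mg g0 sD; rewrite /uniform_measure ge0_integral_mscale//.
rewrite ge0_integral_measure_sum//; congr (_ * _).
rewrite (big_nth 0%R) big_mkord; apply: eq_bigr => j _.
rewrite integral_dirac// diracE mem_set ?mul1e//.
by apply: sD; apply: mem_nth.
Qed.

Lemma Rintegral_uniform s (D : set (borelC R)) u :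
  measurable D -> {within D, continuous u} -> {in s, forall z, D z} ->
  Rintegral (uniform_measure s) D u = avg s u.
Proof.
move=> mD cu sD; have mu := within_continuous_measurable cu.
rewrite /Rintegral integralE ge0_integral_uniform//; last first.
  exact/measurable_funepos/measurable_EFinP.
rewrite ge0_integral_uniform//; last exact/measurable_funeneg/measurable_EFinP.
have -> : \sum_(z <- s) (fun z => (u z)%:E)^\+ z =
  (\sum_(z <- s) Num.max (u z) 0)%:E.
  by rewrite -sumEFin; apply: eq_bigr => z _; rewrite funeposE EFin_max.
have -> : \sum_(z <- s) (fun z => (u z)%:E)^\- z =
  (\sum_(z <- s) Num.max (- u z) 0)%:E.
  by rewrite -sumEFin; apply: eq_bigr => z _; rewrite funenegE EFin_max.
rewrite -!EFinM -EFinB /= -mulrBr -sumrB /avg mulrC; congr (_ / _)%R.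
apply: eq_bigr => z _; have [u0|/ltW u0] := leP 0%R (u z).
  by rewrite max_r ?oppr_le0// subr0.
by rewrite max_l ?oppr_ge0// sub0r opprK.
Qed.

End UniformMeasure.

(** * Counting homomorphisms from connected graphs *)

Section HomomorphismCounts.
Implicit Types (F G : sgraph).

(** A set without outgoing edge is a union of connected components. *)
Lemma gconnected_boundary F (S : {set F}) : gconnected F -> S != finset.set0 ->
  S != finset.setT -> exists x y, [/\ x \in S, y \notin S & sadj x y].
Proof.
move=> /eqP F1 /set0Pn[x0 x0S] ST; apply: contrapT => noedge.
have symF : connect_sym (@sadj F) := sym_connect_sym (@sadj_sym F).
have clS : fingraph.closed (@sadj F) (mem S).
  apply: (intro_closed symF) => x y xy xS; apply: contrapT => /negP yS.
  by apply: noedge; exists x, y.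
move/negP: ST; apply; rewrite -finset.subTset; apply/fintype.subsetP => y _.
suff xy : connect (@sadj F) x0 y by rewrite -(closed_connect clS xy).
rewrite -(root_connect symF).
have /card_le1_eqP : (#|[predI roots (@sadj F) & F]| <= 1)%N by rewrite -F1.
by move=> h; apply/eqP/h; rewrite !inE roots_root.
Qed.

Lemma giso_refl F : giso F F.
Proof. by exists id => //; exists id. Qed.

Lemma giso_sym F1 F2 : giso F1 F2 -> giso F2 F1.
Proof.
move=> [h [g hg gh] hE]; exists g; first by exists h.
by move=> x y; rewrite -hE !gh.
Qed.

Lemma giso_trans F1 F2 F3 : giso F1 F2 -> giso F2 F3 -> giso F1 F3.
Proof.
move=> [h bh hE] [g bg gE]; exists (g \o h); first exact: bij_comp.
by move=> x y /=; rewrite gE hE.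
Qed.

Lemma conn_classes_transversal m :
  is_transversal (conn_classes m)
    (equivalence_partition
       (fun A B : lgraph m => `[< giso (graph_of A) (graph_of B) >])
       (conn_lgraphs m)) (conn_lgraphs m).
Proof.
apply/transversalP/equivalence_partitionP => A B C _ _ _; split.
  by apply/asboolP; exact: giso_refl.
move=> /asboolP AB; apply/asboolP/asboolP => h.
  exact: giso_trans (giso_sym AB) h.
exact: giso_trans AB h.
Qed.

Lemma conn_classes_connected m (A : lgraph m) :
  A \in conn_classes m -> gconnected (graph_of A).
Proof.
by move/(fintype.subsetP (transversal_sub (conn_classes_transversal m)));
  rewrite inE.
Qed.

Lemma card_conn_classes1 : #|conn_classes 1| = 1%N.
Proof.
have trX := conn_classes_transversal 1.
have uniqA (A B : lgraph 1) : A = B.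
  apply/val_inj/setP => -[i j].
  have iE (C : lgraph 1) : ((i, j) \in val C) = false.
    rewrite (ord1 i) (ord1 j); apply/negbTE.
    by case/andP: (valP C) => _ /forallP /(_ ord0).
  by rewrite !iE.
pose E0 : {set 'I_1 * 'I_1} := finset.set0.
have nil_ok : [forall x : 'I_1, forall y : 'I_1, ((x, y) \in E0) == ((y,
  x) \in E0)]
    && [forall x : 'I_1, (x, x) \notin E0].
  by apply/andP; split; [do 2 apply/forallP => ?|apply/forallP => ?];
    rewrite !inE.
pose A0 : lgraph 1 := exist _ E0 nil_ok.
have conA0 : A0 \in conn_lgraphs 1.
  rewrite inE; apply/eqP.
  apply: etrans (n_comp_connect (sym_connect_sym (@sadj_sym (graph_of A0)))
    ord0).
  by apply/eq_n_comp_r => x; rewrite [x]ord1 !inE connect0.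
have PD := and3P trX; case: PD => partP _ _.
apply/eqP; rewrite eqn_leq; apply/andP; split.
  by apply/card_le1_eqP => A B _ _; exact: uniqA.
rewrite (card_transversal trX) card_gt0; apply: contraTneq conA0 => P0.
by rewrite -(cover_partition partP) P0 /finset.cover finset.big_set0 inE.
Qed.

(** The value [None] outside [S] puts the restrictions to all sets [S] into one
    finite type. *)
Definition restriction F G (S : {set F}) (h : {ffun F -> G}) : {ffun F ->
  option G} :=
  [ffun x => if x \in S then Some (h x) else None].

(** A restriction to [y |: S] is determined by its restriction to [S] and its
    value at [y], which is one of the neighbours of its value at [x]. *)
Lemma card_restriction_step F G (H : {set {ffun F -> G}}) (S : {set F}) x y D :
  {in H, forall h, is_hom h} -> (forall w : G, (#|[set w' | sadj w w']%SET| <=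
    D)%N) ->
  x \in S -> sadj x y ->
  (#|restriction (y |: S) @: H| <= #|restriction S @: H| * D)%N.
Proof.
move=> Hhom degD xS xy.
pose forget (q : {ffun F -> option G}) := [ffun z =>
  if z \in S then q z else None].
have forgetE h : forget (restriction (y |: S) h) = restriction S h.
  by apply/ffunP => z; rewrite !ffunE !inE; case: (z \in S); rewrite ?orbT.
rewrite -sum1_card (partition_big forget (mem (restriction S @: H))) /=;
  last first.
  by move=> _ /imsetP[h hH ->]; rewrite forgetE imset_f.
rewrite -sum_nat_const leq_sum// => _ /imsetP[h hH ->].
rewrite sum1dep_card.
pose ev (q : {ffun F -> option G}) := q y.
rewrite -(card_in_imset (f := ev)) => [|q1 q2].
  apply: leq_trans (degD (h x)).
  have <- : #|[set Some w' | w' in [set w' | sadj (h x) w']%SET]%SET| =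
      #|[set w' | sadj (h x) w']%SET|.
    by apply: card_imset => w1 w2 [].
  apply: subset_leq_card.
  apply/fintype.subsetP => _ /imsetP[q + ->]; rewrite inE =>
    /andP[/imsetP[h' h'H ->]].
  rewrite forgetE => /eqP /ffunP /(_ x); rewrite !ffunE xS => -[hx].
  rewrite /ev ffunE !inE eqxx /=; apply: imset_f; rewrite inE -hx.
  by move/(_ _ h'H) : Hhom => /forallP /(_ x) /forallP /(_ y) /implyP; apply.
rewrite !inE => /andP[/imsetP[h1 _ ->]]; rewrite forgetE => /eqP e1.
move=> /andP[/imsetP[h2 _ ->]]; rewrite forgetE => /eqP e2.
rewrite /ev !ffunE !inE eqxx /= => hy; apply/ffunP => z; rewrite !ffunE !inE.
have [->//|_] := eqVneq z y; rewrite /=.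
by have /ffunP /(_ z) := etrans e1 (esym e2); rewrite !ffunE.
Qed.

(** Grow a vertex set along edges: each new vertex is adjacent to an old one,
    hence has at most [D] possible images. *)
Lemma card_hom_le F G (H : {set {ffun F -> G}}) (S : {set F}) D (a : F) :
  gconnected F -> {in H, forall h, is_hom h} ->
  (forall w : G, (#|[set w' | sadj w w']%SET| <= D)%N) ->
  a \in S -> (forall h, h \in H -> forall z, z \in S -> h z = h a) ->
  (#|H| <= #|G| * D ^ (#|F| - #|S|))%N.
Proof.
move=> conF Hhom degD aS Ha.
have base : (#|restriction S @: H| <= #|G|)%N.
  rewrite -cardsT -(card_imset (f := fun w : G => [ffun z =>
    if z \in S then Some w else None]))//.
    apply/subset_leq_card/fintype.subsetP => _ /imsetP[h hH ->].
    apply/imsetP; exists (h a) => //; apply/ffunP => z; rewrite !ffunE.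
    by case: ifP => // zS; rewrite (Ha h).
  by move=> w w' /ffunP/(_ a); rewrite !ffunE aS => -[].
suff grow n (S' : {set F}) : (#|F| - #|S'| = n)%N -> a \in S' ->
    (#|H| <= #|restriction S' @: H| * D ^ n)%N.
  by rewrite (leq_trans (grow _ S erefl aS))// leq_mul2r base orbT.
elim: n S' => [|n ih] S' S'n aS'.
  rewrite expn0 muln1 -(card_in_imset (f := restriction S'))// => h1 h2 _ _ e.
  have S'T : S' = finset.setT.
    by apply/eqP; rewrite eqEcard finset.subsetT cardsT -subn_eq0 S'n.
  by apply/ffunP => z; move/ffunP/(_ z): e; rewrite !ffunE S'T inE => -[].
have [|||x [y [xS' yS' xy]]] := @gconnected_boundary F S'; rewrite //.
- by apply/set0Pn; exists a.
- by apply/eqP => S'T; move: S'n; rewrite S'T cardsT subnn.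
apply: (leq_trans (ih (y |: S') _ _)).
- by rewrite cardsU1 yS' add1n subnS S'n.
- by rewrite !inE aS' orbT.
rewrite expnS mulnA leq_mul2r; apply/orP; right.
exact: card_restriction_step xy.
Qed.



Lemma hom_numE F G : hom_num F G = #|[set h : {ffun F -> G} | is_hom h]%SET|.
Proof. by apply: eq_card => h; rewrite [RHS]inE; apply/idP/idP; rewrite in_setE.
  Qed.

Lemma inj_le_hom_num F G : (inj_num F G <= hom_num F G)%N.
Proof.
rewrite hom_numE; apply/subset_leq_card/fintype.subsetP => h.
by rewrite !inE => /andP[].
Qed.

Lemma hom_num_le F G D : gconnected F ->
  (forall w : G, (#|[set w' | sadj w w']%SET| <= D)%N) ->
  (hom_num F G <= #|G| * D ^ #|F|.-1)%N.
Proof.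
move=> conF degD; rewrite hom_numE.
have [a _] : exists a : F, a \in F.
  have := conF; rewrite /gconnected /ncomp => /eqP F1.
  have : (0 < #|[predI roots (@sadj F) & F]|)%N by rewrite [X in (_ < X)%N]F1.
  by move=> /card_gt0P[a _]; exists a.
rewrite -subn1 -(cards1 a); apply: (card_hom_le (a := a)) => //.
- by move=> h; rewrite inE.
- by rewrite inE.
- by move=> h _ z; rewrite inE => /eqP->.
Qed.

(** A homomorphism that identifies two nodes has one degree of freedom less. *)
Lemma hom_num_le_inj F G D : gconnected F ->
  (forall w : G, (#|[set w' | sadj w w']%SET| <= D)%N) ->
  (hom_num F G <= inj_num F G + #|F| ^ 2 * (#|G| * D ^ (#|F| - 2)))%N.
Proof.
move=> conF degD; rewrite hom_numE.
pose A := [set h : {ffun F -> G} | is_hom h]%SET.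
pose B (p : F * F) := [set h : {ffun F -> G} | is_hom h & h p.1 == h p.2]%SET.
have cB p : p.1 != p.2 -> (#|B p| <= #|G| * D ^ (#|F| - 2))%N.
  move=> pp; have <- : #|[set p.1; p.2]%SET| = 2%N by rewrite cards2 pp.
  apply: (card_hom_le (a := p.1)) => //.
  - by move=> h; rewrite inE => /andP[].
  - by rewrite !inE eqxx.
  - by move=> h; rewrite inE => /andP[_ /eqP e] z;
    rewrite !inE => /orP[] /eqP->.
pose I := [set h : {ffun F -> G} | is_hom h & injectiveb h]%SET.
rewrite -/A -(cardsID I A) leq_add//.
  by apply: subset_leq_card; apply/fintype.subsetP => h;
    rewrite !inE => /andP[].
have sub : A :\: I \subset \bigcup_(p | p.1 != p.2) B p.
  apply/fintype.subsetP => h; rewrite !inE => /andP[];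
    rewrite negb_and => /orP[/negbTE->//|].
  move=> /injectivePn[x [y xy hxy]] hh; apply/finset.bigcupP;
    exists (x, y) => //.
  by rewrite inE hh /= hxy.
apply: (leq_trans (subset_leq_card sub)).
apply: (@leq_trans (\sum_(p : F * F | p.1 != p.2) #|B p|)).
  elim/big_rec2 : _ => [|p n C _ ih]; first by rewrite cards0.
  by rewrite (leq_trans (leq_card_setU _ _))// leq_add2l.
apply: (@leq_trans (\sum_(p : F * F) #|G| * D ^ (#|F| - 2))).
  by rewrite big_mkcond leq_sum// => p _; case: ifP => // /cB.
by rewrite sum_nat_const card_prod mulnn.
Qed.

Lemma max_degree_exists (R : realType) G (d : R) : (0 < #|G|)%N ->
  degrees_le G d ->
  exists2 D : nat, D%:R <= d & forall w : G, (#|[set w' | sadj w w']%SET| <=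
    D)%N.
Proof.
move=> G0 dG; pose deg (w : G) := #|[set w' | sadj w w']%SET|.
have [w0 Dw0] := @bigop.eq_bigmax G deg G0.
exists (\max_w deg w) => [|w]; last exact: bigop.leq_bigmax.
rewrite Dw0; apply: le_trans (dG w0); rewrite ler_nat.
by apply/eq_leq/eq_card => w; rewrite [LHS]inE; apply/idP/idP; rewrite in_setE.
Qed.

Section Densities.
Variable R : realType.
Implicit Types d : R.

Definition inj_ratio F G d k : R := (inj_num F G)%:R / (#|G|%:R * d ^+ k).

Lemma hom_density_connected F G d : gconnected F ->
  hom_density F G d = (hom_num F G)%:R / (#|G|%:R * d ^+ #|F|.-1).
Proof. by move=> /eqP F1; rewrite /hom_density F1 expr1 subn1. Qed.

Lemma inj_ratio_le F G d k : admissible G d -> gconnected F ->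
  (#|F|.-1 < k)%N ->
  0 <= inj_ratio F G d k <= d^-1.
Proof.
move=> [G0 d1 dG] conF Fk; have d0 : 0 < d by apply: lt_le_trans d1.
have G0' : 0 < #|G|%:R :> R by rewrite ltr0n.
rewrite /inj_ratio divr_ge0 ?mulr_ge0 ?exprn_ge0 ?(ltW d0)//=.
have [D Dd degD] := max_degree_exists G0 dG.
rewrite ler_pdivrMr ?mulr_gt0 ?exprn_gt0//.
apply: (@le_trans _ _ (#|G|%:R * d ^+ #|F|.-1)).
  apply: (@le_trans _ _ (#|G| * D ^ #|F|.-1)%:R).
    by rewrite ler_nat (leq_trans (inj_le_hom_num F G))// hom_num_le.
  by rewrite natrM natrX ler_wpM2l// lerXn2r// nnegrE// ltW.
rewrite mulrCA ler_wpM2l//; case: k Fk => // k; rewrite ltnS => Fk.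
by rewrite exprS mulKf ?gt_eqF// ler_weXn2l.
Qed.

Lemma inj_ratio_density F G d : admissible G d -> gconnected F ->
  (1 < #|F|)%N ->
  `|hom_density F G d - inj_ratio F G d #|F|.-1| <= (#|F| ^ 2)%:R / d.
Proof.
move=> [G0 d1 dG] conF F1; have d0 : 0 < d by apply: lt_le_trans d1.
have G0' : 0 < #|G|%:R :> R by rewrite ltr0n.
have [D Dd degD] := max_degree_exists G0 dG.
rewrite hom_density_connected// /inj_ratio -mulrBl -natrB ?inj_le_hom_num//.
rewrite ger0_norm ?divr_ge0 ?mulr_ge0 ?exprn_ge0 ?(ltW d0)//.
rewrite ler_pdivrMr ?mulr_gt0 ?exprn_gt0//.
apply: (@le_trans _ _ (#|F| ^ 2 * (#|G| * D ^ (#|F| - 2)))%:R).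
  by rewrite ler_nat leq_subLR hom_num_le_inj.
rewrite natrM -[leRHS]mulrA ler_wpM2l// natrM [leRHS]mulrCA ler_wpM2l// natrX.
have -> : #|F|.-1 = (#|F| - 2).+1 by case: #|F| F1 => [|[|n]]//=;
  rewrite subSS subn1.
by rewrite exprS mulKf ?gt_eqF// lerXn2r// nnegrE// ltW.
Qed.

End Densities.

End HomomorphismCounts.

(** * Convergence of the moments of the root measures *)

Section ComplexLimits.
Variable R : realType.

Lemma cvg_complex (a : nat -> R[i]) (l : R[i]) :
  complex.Re (a n) @[n --> \oo] --> complex.Re l ->
  complex.Im (a n) @[n --> \oo] --> complex.Im l -> a n @[n --> \oo] --> l.
Proof.
move=> aR aI; apply/cvgrPdist_lt => e; rewrite ltcE => /andP[/eqP eI e0].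
have e2 : 0 < complex.Re e / 2 by rewrite divr_gt0.
move/cvgrPdist_lt : aR => /(_ _ e2) aR; move/cvgrPdist_lt : aI => /(_ _ e2) aI.
near=> n; suff : normc (l - a n) < complex.Re e.
  by rewrite normr_normc ltcE /= eI eqxx.
rewrite (le_lt_trans (normc_le_ReIm _))// (splitr (complex.Re e)) ltrD//.
  by rewrite cReB; near: n.
have -> : complex.Im (l - a n) = complex.Im l - complex.Im (a n).
  by case: (l) (a n) => x y [x' y'].
by near: n.
Unshelve. all: by end_near. Qed.

Lemma cvg_cRe (a : nat -> R[i]) (l : R[i]) : a n @[n --> \oo] --> l ->
  complex.Re (a n) @[n --> \oo] --> complex.Re l.
Proof. by move=> al; apply: (continuous_cvg _ _ al); exact: continuous_Re. Qed.

Lemma cvg_cIm (a : nat -> R[i]) (l : R[i]) : a n @[n --> \oo] --> l ->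
  complex.Im (a n) @[n --> \oo] --> complex.Im l.
Proof. by move=> al; apply: (continuous_cvg _ _ al); exact: continuous_Im. Qed.

Lemma cvg_mulc_real (z : R[i]) (x : nat -> R) (l : R) : x n @[n --> \oo] -->
  l ->
  z * (x n)%:C @[n --> \oo] --> z * l%:C.
Proof.
move=> xl; apply: cvg_complex.
  by rewrite cReZr; under eq_fun do rewrite cReZr; exact: cvgMl_tmp.
by rewrite cImZr; under eq_fun do rewrite cImZr; exact: cvgMl_tmp.
Qed.

End ComplexLimits.

Section Moments.
Variable R : realType.
Variable f : sgraph -> {poly R[i]}.
Hypothesis f_monic : monic_graph_poly f.

Lemma poly_rootsE G : f G = \prod_(z <- poly_roots (f G)) ('X - z%:P).
Proof.
rewrite /poly_roots; case: closed_field_poly_normal => r /= {1}->.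
by have [/monicP -> _] := f_monic G; rewrite scale1r.
Qed.

Lemma size_poly_roots G : size (poly_roots (f G)) = #|G|.
Proof.
have [_] := f_monic G; rewrite {1}poly_rootsE.
by rewrite (size_prod_XsubC (poly_roots (f G)) id) => -[].
Qed.

Lemma mem_poly_roots G z : (z \in poly_roots (f G)) = root (f G) z.
Proof. by rewrite [in RHS]poly_rootsE root_prod_XsubC. Qed.

Definition scaled_roots G (d : R) := [seq z / d%:C | z <- poly_roots (f G)].

Lemma size_scaled_roots G d : size (scaled_roots G d) = #|G|.
Proof. by rewrite size_map size_poly_roots. Qed.

Variable C : R.
Hypothesis f_roots : root_bound f C.

Lemma scaled_roots_le G (d : R) : admissible G d ->
  {in scaled_roots G d, forall z, normc z <= C}.
Proof.
move=> [G0 d1 dG] _ /mapP[z + ->]; rewrite mem_poly_roots => /(f_roots dG).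
have d0 : 0 < d by apply: lt_le_trans d1.
rewrite normr_normc lecR normcM normcV normc_realc gtr0_norm// => zC.
by rewrite ler_pdivrMr.
Qed.

Lemma root_bound_ge0 G (d : R) : admissible G d -> 0 <= C.
Proof.
move=> adm; have [G0 _ _] := adm; have := scaled_roots_le adm.
have := size_scaled_roots G d; case: (scaled_roots G d) => [s0|z s _ h].
  by move: G0; rewrite -s0.
by apply: le_trans (normc_ge0 z) (h z _); rewrite inE eqxx.
Qed.

(** The integral of [z^k] against the root measure, in the form to which the
    expansion of the power sums applies. *)
Definition moment k G (d : R) : R[i] :=
  power_sum f k G * ((#|G|%:R * d ^+ k)^-1)%:C.

Lemma momentE k G (d : R) : d != 0 ->
  moment k G d = (\sum_(z <- scaled_roots G d) z ^+ k) * ((#|G|%:R)^-1)%:C.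
Proof.
move=> d0; rewrite /moment /power_sum invfM mulrC rmorphM /= -mulrA mulrC.
congr (_ * _); rewrite big_map mulr_sumr; apply: eq_bigr => z _.
by rewrite exprMn mulrC -fmorphV -rmorphXn/= exprVn.
Qed.

Lemma avg_Re_moment k G (d : R) : d != 0 ->
  avg (scaled_roots G d) (fun z => complex.Re (z ^+ k)) =
    complex.Re (moment k G d).
Proof. by move=> d0; rewrite momentE// cReZr cRe_sum /avg size_scaled_roots.
  Qed.

Lemma avg_Im_moment k G (d : R) : d != 0 ->
  avg (scaled_roots G d) (fun z => complex.Im (z ^+ k)) =
    complex.Im (moment k G d).
Proof. by move=> d0; rewrite momentE// cImZr cIm_sum /avg size_scaled_roots.
  Qed.

Variable c : nat -> sgraph -> R[i].
Hypothesis hc : power_sum_coeffs f c.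

Lemma moment_inj_ratio k G (d : R) : (0 < k)%N ->
  moment k G d = \sum_(2 <= m < k.+2) \sum_(F in conn_classes m)
    c k (graph_of F) * (inj_ratio (graph_of F) G d k)%:C.
Proof.
case: hc => _ _ h k0; rewrite /moment h// mulr_suml; apply: eq_bigr => m _.
rewrite mulr_suml; apply: eq_bigr => F _; rewrite -mulrA; congr (_ * _).
by rewrite /inj_ratio rmorphM rmorph_nat.
Qed.

Variables (G : nat -> sgraph) (d : nat -> R).
Hypothesis hadm : admissible_seq G d.
Hypothesis hd : d n @[n --> \oo] --> +oo.
Hypothesis hconv : convergent_seq G d \/
       forall F : sgraph, gconnected F -> c #|F|.-1 F != 0 ->
         cvgn (fun n => hom_density F (G n) (d n)).

Lemma admissible_gt0 n : 0 < d n.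
Proof. by have [_ d1 _] := hadm n; apply: lt_le_trans d1. Qed.

Lemma invd_cvg0 (a : R) : a / d n @[n --> \oo] --> 0.
Proof.
rewrite -[X in _ --> X](mulr0 a); apply: cvgMl_tmp.
apply/gtr0_cvgV0 => //; near=> n; exact: admissible_gt0.
Unshelve. all: by end_near. Qed.

Lemma inj_ratio_cvg0 F k : gconnected F -> (#|F|.-1 < k)%N ->
  inj_ratio F (G n) (d n) k @[n --> \oo] --> 0.
Proof.
move=> conF Fk; apply: (@squeeze_cvgr _ _ _ _ (fun=> 0) (fun n => 1 / d n)).
- near=> n; rewrite div1r; exact: inj_ratio_le.
- exact: cvg_cst.
- exact: invd_cvg0.
Unshelve. all: by end_near. Qed.

(** Injective and arbitrary homomorphisms have the same limiting density, since
    the noninjective ones are fewer by a factor of order [1 / d n]. *)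
Lemma inj_ratio_cvg F k : gconnected F -> (0 < k)%N -> #|F|.-1 = k ->
  c k F != 0 -> inj_ratio F (G n) (d n) k @[n --> \oo] --> lim_density G d F.
Proof.
move=> conF k0 kE; rewrite -{}kE in k0 * => cF.
have F1 : (1 < #|F|)%N by case: #|F| k0 => [|[]].
have homF : cvgn (fun n => hom_density F (G n) (d n)).
  by case: hconv => [|h]; [exact|exact: h].
rewrite -[lim_density _ _ _]subr0.
rewrite (_ : (fun n => _) = fun n => hom_density F (G n) (d n) -
    (hom_density F (G n) (d n) - inj_ratio F (G n) (d n) #|F|.-1)); last first.
  by apply/funext => n; rewrite subKr.
apply: cvgB; first exact: homF.
apply: norm_cvg0; apply: (@squeeze_cvgr _ _ _ _ (fun=> 0) (fun n => (#|F|
  ^ 2)%:R / d n)).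
- near=> n; rewrite normr_ge0; exact: inj_ratio_density.
- exact: cvg_cst.
- exact: invd_cvg0.
Unshelve. all: by end_near. Qed.

Lemma hom_density1 (F G' : sgraph) (d' : R) : #|F| = 1%N -> gconnected F ->
  (0 < #|G'|)%N ->
  hom_density F G' d' = 1.
Proof.
move=> F1 conF G0; rewrite hom_density_connected// F1 expr0 mulr1.
have -> : hom_num F G' = #|G'|.
  rewrite -[RHS]expn1 -F1 -card_ffun hom_numE; apply: eq_card => h;
    rewrite !inE.
  apply/forallP => x; apply/forallP => y; apply/implyP.
  have /card_le1_eqP Fle : (#|F| <= 1)%N by rewrite F1.
  by rewrite (Fle x y) ?inE// sadj_irr.
by rewrite divff// pnatr_eq0 -lt0n.
Qed.

(** Only the graphs with [k + 1] nodes survive in the limit: the injective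
    homomorphisms from a connected graph with fewer nodes are too few. *)
Lemma moment_cvg k : moment k (G n) (d n) @[n --> \oo] -->
  \sum_(F in conn_classes k.+1)
          c k (graph_of F) * (lim_density G d (graph_of F))%:C.
Proof.
have [->|k0] := posnP k.
  rewrite (eq_bigr (fun=> 1)) => [|A Acl].
    rewrite sumr_const card_conn_classes1 mulr1n.
    rewrite (_ : (fun n => _) = fun=> 1); first exact: cvg_cst.
    apply/funext => n; rewrite /moment /power_sum.
    under eq_bigr do rewrite expr0.
    rewrite big_const_seq count_predT iter_addr_0 size_poly_roots expr0 mulr1.
    rewrite fmorphV/= rmorph_nat divff// pnatr_eq0 -lt0n.
    by have [] := hadm n.
  have conA := conn_classes_connected Acl.
  have A1 : #|graph_of A| = 1%N by rewrite /= card_ord.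
  have [_ -> // _] := hc; rewrite mul1r /lim_density.
  rewrite (_ : (fun n => _) = fun=> 1); first by rewrite lim_cst.
  by apply/funext => n; rewrite hom_density1//; have [] := hadm n.
pose l m (F : lgraph m) : R[i] :=
  if m == k.+1 then c k (graph_of F) * (lim_density G d (graph_of F))%:C else 0.
rewrite (_ : \sum_(F in _) _ = \sum_(2 <= m < k.+2) \sum_(F in conn_classes m) l
  m F).
  under eq_fun do rewrite moment_inj_ratio//.
  apply: cvgn_sum_nat => m /andP[m2 mk].
  apply: cvgn_sum => A Acl; have conA := conn_classes_connected Acl.
  have Am : #|graph_of A| = m by rewrite /= card_ord.
  rewrite /l; case: eqP => [mE|/eqP mk'].
    have [c0|c0] := eqVneq (c k (graph_of A)) 0.
      under eq_fun do rewrite c0 mul0r; rewrite c0 mul0r; exact: cvg_cst.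
    by apply: cvg_mulc_real; apply: inj_ratio_cvg => //; rewrite Am mE.
  rewrite -[X in _ --> X](mulr0 (c k (graph_of A))) -(rmorph0 (real_complex R)).
  apply: cvg_mulc_real; apply: inj_ratio_cvg0 => //; rewrite Am.
  by move: mk mk' m2; clear; case: m => //= m;
    rewrite !ltnS eqSS leq_eqVlt => /orP[->//|->].
rewrite big_nat_recr//= [X in X + _]big1_seq ?add0r => [|m]; last first.
  rewrite mem_index_iota => /andP[_ /andP[_ mk]]; apply: big1 => F _.
  by rewrite /l (ltn_eqF mk).
by apply: eq_bigr => F _; rewrite /l eqxx.
Qed.

End Moments.

(** * The distribution function of a positive functional *)

Section RieszInterval.
Variable R : realType.

Definition clamp (t : R) : R := Num.max 0 (Num.min 1 t).

Lemma clamp_ge0 t : 0 <= clamp t.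
Proof. by rewrite /clamp le_max lexx. Qed.

Lemma clamp_le1 t : clamp t <= 1.
Proof. by rewrite /clamp ge_max ler01 ge_min lexx. Qed.

Lemma clamp_le s t : s <= t -> clamp s <= clamp t.
Proof.
move=> st; rewrite /clamp ge_max le_max lexx /= le_max; apply/orP; right.
by rewrite le_min !ge_min lexx st !orbT.
Qed.

Lemma clamp0 t : t <= 0 -> clamp t = 0.
Proof. by move=> t0; rewrite /clamp max_l// ge_min t0 orbT. Qed.

Lemma clamp1 t : 1 <= t -> clamp t = 1.
Proof. by move=> t1; rewrite /clamp min_l// max_r. Qed.

Lemma clampB s t : s <= t -> clamp t - clamp s <= t - s.
Proof.
move=> st; have [t0|/ltW t0] := leP t 0.
  by rewrite !clamp0 ?subrr ?subr_ge0// (le_trans st).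
have [s1|/ltW s1] := leP 1 s.
  by rewrite !clamp1 ?subrr ?subr_ge0// (le_trans s1).
apply: lerB; first by rewrite /clamp ge_max t0 ge_min lexx orbT.
by rewrite /clamp le_max le_min s1 lexx orbT.
Qed.

Lemma clamp_lipschitz s t : `|clamp s - clamp t| <= `|s - t|.
Proof.
wlog st : s t / s <= t => [h|].
  by have [st|/ltW ts] := leP s t; [exact: h|rewrite distrC [leRHS]distrC;
    exact: h].
rewrite distrC [leRHS]distrC !ger0_norm ?subr_ge0 ?clamp_le//.
exact: clampB.
Qed.

(** A continuous majorant of the indicator of the half-line up to [x]. *)
Definition ramp (x del y : R) : R := clamp ((x - y) / del + 1).

Lemma ramp_continuous x del : continuous (ramp x del).
Proof.
move=> y; apply/cvgrPdist_le => e e0.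
have : (fun y : R => (x - y) / del + 1) z @[z --> y] --> (x - y) / del + 1.
  apply: cvgD; last exact: cvg_cst.
  by apply: cvgMr_tmp; apply: cvgB; [exact: cvg_cst|exact: cvg_id].
move/cvgrPdist_le => /(_ e e0); apply: filterS => z.
exact/le_trans/clamp_lipschitz.
Qed.

Lemma ramp_left x del y : 0 < del -> y <= x -> ramp x del y = 1.
Proof. by move=> d0 yx; apply: clamp1; rewrite lerDr divr_ge0 ?subr_ge0// ltW.
  Qed.

Lemma ramp_right x del y : 0 < del -> x + del <= y -> ramp x del y = 0.
Proof.
move=> d0 xy; apply: clamp0; rewrite -lerBrDr sub0r ler_pdivrMr// mulN1r; lra.
Qed.

Lemma ramp_le x x' del y : 0 < del -> x <= x' -> ramp x del y <= ramp x' del y.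
Proof. by move=> d0 xx; apply: clamp_le; rewrite lerD2r ler_pM2r ?invr_gt0//
  lerD2r. Qed.

(** [Lam] stands for a normalised positive linear functional on C([-C, C]); it is
    fed functions on the whole line, but [Lam_le] makes it depend only on their
    values on [-C, C]. *)
Variables (C : R) (Lam : (R -> R) -> R).
Hypothesis C0 : 0 <= C.
Hypothesis LamD : forall f g : R -> R, continuous f -> continuous g ->
  Lam (fun y => f y + g y) = Lam f + Lam g.
Hypothesis LamZ : forall (a : R) (f : R -> R), continuous f ->
  Lam (fun y => a * f y) = a * Lam f.
Hypothesis Lam_le : forall f g : R -> R, continuous f -> continuous g ->
  (forall y, `|y| <= C -> f y <= g y) -> Lam f <= Lam g.
Hypothesis Lam1 : Lam (fun=> 1) = 1.

Lemma Lam_cst (a : R) : Lam (fun=> a) = a.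
Proof.
have -> : (fun=> a) = (fun y : R => a * (fun=> 1 : R) y) by apply/funext => y;
  rewrite mulr1.
by rewrite LamZ ?Lam1 ?mulr1// => y; exact: cvg_cst.
Qed.

Lemma Lam_eq (f g : R -> R) : continuous f -> continuous g ->
  (forall y, `|y| <= C -> f y = g y) -> Lam f = Lam g.
Proof.
move=> cf cg fg; apply/eqP; rewrite eq_le !Lam_le// => y yC; rewrite fg//.
Qed.

Lemma Lam_dist (f g : R -> R) (e : R) : continuous f -> continuous g ->
  (forall y, `|y| <= C -> `|f y - g y| <= e) -> `|Lam f - Lam g| <= e.
Proof.
move=> cf cg fg; have ce (a : R) : continuous (fun _ : R => a) by move=> y;
  exact: cvg_cst.
have gD (a : R) : Lam g + a = Lam (fun y => g y + a).
  by rewrite (LamD cg (ce a)) Lam_cst.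
have cgD (a : R) : continuous (fun y => g y + a).
  by move=> y; apply: cvgD; [exact: cg|exact: cvg_cst].
rewrite ler_distl !gD; apply/andP.
split; apply: Lam_le => // y /fg; rewrite ler_distl => /andP[] //.
Qed.

(** The mass of the half-line up to [x] is approached from above by the ramps; the
    infimum over their widths is what makes it right continuous in [x]. *)
Definition Lam_cdf (x : R) : R := inf [set Lam (ramp x del) | del in [set del |
  0 < del]].

Let F := Lam_cdf.

Lemma Lam_cdf_le x del : 0 < del -> F x <= Lam (ramp x del).
Proof.
move=> d0; apply: ge_inf; last by exists del.
exists 0 => _ [e e0 <-]; rewrite -(Lam_cst 0); apply: Lam_le.
- by move=> y; exact: cvg_cst.
- exact: ramp_continuous.
- by move=> y _; exact: clamp_ge0.
Qed.

Lemma Lam_cdf_lb x a : (forall del, 0 < del -> a <= Lam (ramp x del)) ->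
  a <= F x.
Proof.
move=> h; apply: lb_le_inf; first by exists (Lam (ramp x 1)); exists 1 => //=.
by move=> _ [del d0 <-]; exact: h.
Qed.

(** Together with [Lam_cdf_le] this squeezes [Lam] at a ramp between two values of
    the distribution function. *)
Lemma Lam_ramp_le x del : 0 < del -> Lam (ramp x del) <= F (x + del).
Proof.
move=> d0; apply: Lam_cdf_lb => e e0; apply: Lam_le; [exact:
  ramp_continuous..|].
move=> y _; have [yx|/ltW xy] := leP y (x + del).
  by rewrite [leRHS]ramp_left// clamp_le1.
by rewrite ramp_right// clamp_ge0.
Qed.

Lemma Lam_cdf_nondecreasing : nondecreasing F.
Proof.
move=> x x' xx; apply: Lam_cdf_lb => del d0; apply:
  (le_trans (Lam_cdf_le x d0)).
by apply: Lam_le; [exact: ramp_continuous..|move=> y _; exact: ramp_le].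
Qed.

Lemma Lam_cdf0 x : x < - C -> F x = 0.
Proof.
move=> xC; have d0 : 0 < - C - x by rewrite subr_gt0.
apply/eqP; rewrite eq_le; apply/andP; split.
  rewrite (le_trans (Lam_cdf_le x d0))// -[leRHS](Lam_cst 0); apply: Lam_le.
  - exact: ramp_continuous.
  - by move=> y; exact: cvg_cst.
  - by move=> y; rewrite ler_norml => /andP[yC _]; rewrite ramp_right//; lra.
apply: Lam_cdf_lb => del _; rewrite -[leLHS](Lam_cst 0); apply: Lam_le.
- by move=> y; exact: cvg_cst.
- exact: ramp_continuous.
- by move=> y _; exact: clamp_ge0.
Qed.

Lemma Lam_ramp1 x del : 0 < del -> C <= x -> Lam (ramp x del) = 1.
Proof.
move=> d0 Cx; rewrite -[RHS]Lam1; apply: Lam_eq.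
- exact: ramp_continuous.
- by move=> y; exact: cvg_cst.
- by move=> y; rewrite ler_norml => /andP[_ yC]; rewrite ramp_left//
  (le_trans yC).
Qed.

Lemma Lam_cdf1 x : C <= x -> F x = 1.
Proof.
move=> Cx; apply/eqP; rewrite eq_le; apply/andP; split.
  by rewrite (le_trans (Lam_cdf_le x ltr01))// Lam_ramp1.
by apply: Lam_cdf_lb => del d0; rewrite Lam_ramp1.
Qed.

(** A ramp of fixed width moves uniformly continuously with its position. *)
Lemma Lam_cdf_right_continuous : right_continuous F.
Proof.
move=> x; apply/cvgrPdist_le => e e0; have e2 : 0 < e / 2 by rewrite divr_gt0.
have hinf : has_inf [set Lam (ramp x del) | del in [set del | 0 < del]].
  split; first by exists (Lam (ramp x 1)); exists 1 => //=.
  by exists (F x) => _ [del d0 <-]; exact: Lam_cdf_le.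
have [_ [del /= d0 <-] hdel] := inf_adherent e2 hinf.
near=> y; have xy : x < y by near: y; exact: nbhs_right_gt.
have yx : y < x + del * (e / 2).
  by near: y; apply: nbhs_right_lt; rewrite ltrDl mulr_gt0.
rewrite ler0_norm ?subr_le0 ?Lam_cdf_nondecreasing ?(ltW xy)// opprB.
rewrite lerBlDr (splitr e) -addrA [X in _ + X]addrC.
rewrite (le_trans (Lam_cdf_le y d0))//.
apply: (@le_trans _ _ (Lam (fun t => e / 2 + ramp x del t))).
  apply: Lam_le; first exact: ramp_continuous.
    by move=> t; apply: cvgD; [exact: cvg_cst|exact: ramp_continuous].
  move=> t _; rewrite -lerBlDr (le_trans (clampB _))//.
    by rewrite lerD2r ler_pM2r ?invr_gt0// lerD2r ltW.
  rewrite [leLHS](_ : _ = (y - x) / del); last by ring.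
  by rewrite ler_pdivrMr// mulrC lerBlDl ltW.
rewrite LamD; last 2 first.
  by move=> t; exact: cvg_cst.
  exact: ramp_continuous.
by rewrite Lam_cst lerD2l; exact: ltW.
Unshelve. all: by end_near. Qed.

Lemma Lam_sum (n : nat) (a : nat -> R) (f : nat -> R -> R) :
  (forall i, continuous (f i)) ->
  continuous (fun y => \sum_(0 <= i < n) a i * f i y) /\
  Lam (fun y => \sum_(0 <= i < n) a i * f i y) = \sum_(0 <=
    i < n) a i * Lam (f i).
Proof.
move=> cf; elim: n => [|n [ih1 ih2]].
  split; first by move=> y; under eq_fun do rewrite big_nil; exact: cvg_cst.
  by rewrite big_nil; under eq_fun do rewrite big_nil; exact: Lam_cst.
have caf : continuous (fun y => a n * f n y).
  by move=> y; apply: cvgMl_tmp; exact: cf.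
have -> : (fun y => \sum_(0 <= i < n.+1) a i * f i y) =
    (fun y => \sum_(0 <= i < n) a i * f i y + a n * f n y).
  by apply/funext => y; rewrite big_nat_recr.
split; first by move=> y; apply: cvgD; [exact: ih1|exact: caf].
by rewrite big_nat_recr//= -ih2 -(LamZ (a n) (cf n)) -LamD.
Qed.

Lemma sum_by_parts (n : nat) (g e : nat -> R) :
  \sum_(0 <= i < n) g i.+1 * (e i.+1 - e i) =
  g n * e n - g 0%N * e 0%N - \sum_(0 <= i < n) (g i.+1 - g i) * e i.
Proof.
elim: n => [|n ih]; first by rewrite !big_nil subrr subr0.
by rewrite !big_nat_recr//= ih; ring.
Qed.

(** The partition of unity made of the differences of consecutive ramps turns
    [g] into a Riemann-Stieltjes sum, up to its oscillation on the mesh. *)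
Lemma ramp_riemann_sum (g : R -> R) (N : nat) (h e : R) :
  let x i := - (C + 1) + i%:R * h in
  0 < h <= 1 -> C <= x N ->
  (forall y i, `|y| <= C -> (i < N)%N -> `|y - x i.+1| <= h ->
    `|g y - g (x i.+1)| <= e) ->
  forall y, `|y| <= C ->
  `|g y - \sum_(0 <= i < N) g (x i.+1) * (ramp (x i.+1) h y - ramp (x i) h y)|
    <= e.
Proof.
move=> x /andP[h0 h1] xN ge y yC; pose r i := ramp (x i) h y.
have xS i : x i.+1 = x i + h by rewrite /x -natr1 mulrDl mul1r addrA.
have r0 : r 0%N = 0.
  rewrite /r ramp_right// /x mul0r addr0; move: yC;
    rewrite ler_norml => /andP[]; lra.
have rN : r N = 1.
  by rewrite /r ramp_left// (le_trans _ xN)//; move: yC;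
    rewrite ler_norml => /andP[].
have sumr : \sum_(0 <= i < N) (r i.+1 - r i) = 1 by rewrite telescope_sumr//
  rN r0 subr0.
have -> : g y - \sum_(0 <= i < N) g (x i.+1) * (r i.+1 - r i) =
    \sum_(0 <= i < N) (g y - g (x i.+1)) * (r i.+1 - r i).
  rewrite -[X in X - _]mulr1 -sumr mulr_sumr -sumrB; apply: eq_bigr => i _.
  by rewrite mulrBl.
rewrite (le_trans (ler_norm_sum _ _ _))// -[leRHS]mulr1 -sumr mulr_sumr.
rewrite big_nat [leRHS]big_nat ler_sum// => i /andP[_ iN].
have ri : 0 <= r i.+1 - r i by rewrite subr_ge0 ramp_le// xS lerDl ltW.
rewrite normrM (ger0_norm ri); have [yl|yl] := leP y (x i).
  by rewrite /r !ramp_left// ?subrr ?mulr0// xS (le_trans yl)// lerDl ltW.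
have [yr|yr] := leP (x i.+1 + h) y.
  by rewrite /r !ramp_right// ?subrr ?mulr0// (le_trans _ yr)//
    lerD2r xS lerDl ltW.
rewrite ler_wpM2r// ge// ler_norml; move: yl yr; rewrite xS; lra.
Qed.

(** By summation by parts, replacing the values of [Lam] at the ramps by those
    of the distribution function costs at most the oscillation of [g]. *)
Lemma Lam_riemann_sum (g : R -> R) (N : nat) (h e : R) : continuous g ->
  let x i := - (C + 1) + i%:R * h in
  0 < h <= 1 -> C <= x N -> 0 <= e ->
  (forall y i, `|y| <= C -> (i < N)%N -> `|y - x i.+1| <= h ->
    `|g y - g (x i.+1)| <= e) ->
  (forall i, (i < N)%N -> `|g (x i.+1) - g (x i)| <= e) ->
  `|Lam g - \sum_(0 <= i < N) g (x i.+1) * (F (x i.+1) - F (x i))| <= e + e.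
Proof.
move=> cg x h01 xN e0 ge1 ge2; have /andP[h0 h1] := h01.
have xS i : x i.+1 = x i + h by rewrite /x -natr1 mulrDl mul1r addrA.
pose psi i y := ramp (x i.+1) h y - ramp (x i) h y.
have cr i : continuous (ramp (x i) h) by exact: ramp_continuous.
have cpsi i : continuous (psi i).
  by move=> y; apply: cvgB; [exact: cr|exact: cr].
have Lpsi i : Lam (psi i) = Lam (ramp (x i.+1) h) - Lam (ramp (x i) h).
  have -> : psi i = (fun y => ramp (x i.+1) h y + -1 * ramp (x i) h y).
    by apply/funext => y; rewrite mulN1r.
  have cN : continuous (fun y => -1 * ramp (x i) h y).
    by move=> y; apply: cvgMl_tmp; exact: cr.
  by rewrite (LamD (cr i.+1) cN) (LamZ _ (cr i)) mulN1r.
have [cs Ls] := Lam_sum N (fun i => g (x i.+1)) cpsi.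
rewrite -(subrK (Lam (fun y => \sum_(0 <= i < N) g (x i.+1) * psi i y)) (Lam
  g)).
rewrite -addrA (le_trans (ler_normD _ _))// lerD//.
  by apply: Lam_dist => // y yC; exact: ramp_riemann_sum yC.
pose E i := Lam (ramp (x i) h) - F (x i).
rewrite Ls -sumrB (eq_bigr (fun i => g (x i.+1) * (E i.+1 - E i))); last first.
  by move=> i _; rewrite Lpsi /E; ring.
have E0 : E 0%N = 0.
  have x0 : x 0%N = - (C + 1) by rewrite /x mul0r addr0.
  rewrite /E x0 (Lam_cdf0 (x := - (C + 1))) ?subr0; last lra.
  apply/eqP; rewrite eq_le; apply/andP; split; last first.
    by rewrite -(Lam_cdf0 (x := - (C + 1))) ?Lam_cdf_le//; lra.
  rewrite -[leRHS](Lam_cst 0); apply: Lam_le.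
  - exact: ramp_continuous.
  - by move=> y; exact: cvg_cst.
  - by move=> y; rewrite ler_norml => /andP[yC _]; rewrite ramp_right//; lra.
have EN : E N = 0 by rewrite /E Lam_ramp1// Lam_cdf1// subrr.
rewrite (sum_by_parts N (g \o x) E) E0 EN !mulr0 subrr sub0r normrN.
apply: (@le_trans _ _ (\sum_(0 <= i < N) e * (F (x i.+1) - F (x i)))).
  rewrite (le_trans (ler_norm_sum _ _ _))// big_nat [leRHS]big_nat ler_sum//
    => i /andP[_ iN].
  have Ei : 0 <= E i by rewrite subr_ge0 Lam_cdf_le.
  rewrite normrM (ger0_norm Ei) ler_pM ?ge2//.
  by rewrite /E lerD2r xS Lam_ramp_le.
rewrite -mulr_sumr telescope_sumr// ler_piMr//.
by rewrite (Lam_cdf1 xN) (Lam_cdf0 (x := x 0%N)) ?subr0// /x mul0r addr0; lra.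
Qed.

End RieszInterval.

(** * Riesz representation on an interval *)

Section RieszMeasure.
Variable R : realType.

Lemma fine_bounded_integrable (mu : probability (measurableTypeR R) R)
    (D : set (measurableTypeR R)) (g : R -> R) (M : R) :
  measurable D -> continuous g -> (forall y, `|g y| <= M) ->
  mu.-integrable D (EFin \o g).
Proof.
move=> mD cg gM; apply: measurable_bounded_integrable => //.
- by apply: (le_lt_trans (probability_le1 mu mD)); exact: ltry.
- by apply: measurable_funTS; exact: continuous_measurable_fun.
- exists M; split; first exact: num_real.
  by move=> m Mm y _ /=; exact: le_trans (gM y) (ltW Mm).
Qed.

Lemma Rintegral_ocitv_approx (mu : probability (measurableTypeR R) R)
    (g : R -> R) (M a b e : R) :
  continuous g -> (forall y, `|g y| <= M) ->
  (forall y, a < y <= b -> `|g y - g b| <= e) ->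
  `|Rintegral mu `]a, b]%classic g - g b * fine (mu `]a, b]%classic)|
    <= e * fine (mu `]a, b]%classic).
Proof.
move=> cg gM ge; have mI : measurable (`]a, b]%classic :
  set (measurableTypeR R)).
  exact: measurable_itv.
have cc (r : R) : continuous (fun _ : R => r) by move=> y; exact: cvg_cst.
have ig := fine_bounded_integrable mu mI cg gM.
have ic (r : R) : mu.-integrable `]a, b]%classic (EFin \o (fun=> r)).
  exact: (fine_bounded_integrable mu mI (cc r) (fun=> lexx `|r|)).
rewrite -!Rintegral_cst// -RintegralB//.
have cgb : continuous (fun y => g y - g b).
  by move=> y; apply: cvgB; [exact: cg|exact: cvg_cst].
have gbM y : `|g y - g b| <= M + M by rewrite (le_trans (ler_normB _ _))// lerD.
rewrite (le_trans (le_normr_Rintegral _ _))//.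
  exact: (fine_bounded_integrable mu mI cgb gbM).
apply: le_Rintegral => //.
  apply: (fine_bounded_integrable mu mI (M := M + M)) => [y|y].
    by apply: (@cvg_norm _ R^o); exact: cgb.
  by rewrite normr_id.
Qed.

Lemma lebesgue_stieltjes_ocitv (F : cumulative R R) (a b : R) : a <= b ->
  lebesgue_stieltjes_measure F `]a, b]%classic = (F b - F a)%:E.
Proof.
move=> ab; rewrite /lebesgue_stieltjes_measure /measure_extension.
by rewrite measurable_mu_extE/=; [rewrite wlength_itv_bnd|exact: is_ocitv].
Qed.

Lemma Rintegral_riemann_sum (F : cumulativeBounded (0 : R) (1 : R)) (g : R -> R)
    (M e : R) (x : nat -> R) (N : nat) :
  continuous g -> (forall y, `|g y| <= M) -> (forall i, x i <= x i.+1) ->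
  (forall i y, (i < N)%N -> x i < y <= x i.+1 -> `|g y - g (x i.+1)| <= e) ->
  `|Rintegral (lebesgue_stieltjes_measure F) `]x 0%N, x N]%classic g -
    \sum_(0 <= i < N) g (x i.+1) * (F (x i.+1) - F (x i))|
   <= e * (F (x N) - F (x 0%N)).
Proof.
move=> cg gM xx; elim: N => [|N ih] ge.
  rewrite big_nil subr0 subrr mulr0 set_itvoc0 Rintegral_set0 normr0//.
have x0N : x 0%N <= x N.
  by elim: (N) => // n xn; rewrite (le_trans xn).
pose mu : probability (measurableTypeR R) R := lebesgue_stieltjes_measure F.
have m1 : measurable (`]x 0%N, x N]%classic : set (measurableTypeR R)) by exact:
  measurable_itv.
have m2 : measurable (`]x N, x N.+1]%classic :
  set (measurableTypeR R)) by exact: measurable_itv.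
have -> : `]x 0%N, x N.+1]%classic = (`]x 0%N, x N] `|` `]x N, x N.+1])%classic.
  by rewrite -itv_bndbnd_setU// bnd_simp.
rewrite (Rintegral_setU (mu := mu))//; last 2 first.
- apply: (fine_bounded_integrable mu _ cg gM); exact: measurableU.
- apply/disj_setPS => y [] /=; rewrite !in_itv/= => /andP[_ yN] /andP[Ny _].
  by move: (lt_le_trans Ny yN); rewrite ltxx.
rewrite big_nat_recr//= opprD addrACA (le_trans (ler_normD _ _))//.
rewrite [leRHS](_ : _ = e * (F (x N) - F (x 0%N)) + e * (F (x N.+1) - F (x N)));
  last by ring.
apply: lerD; first by apply: ih => i y iN; apply: ge; rewrite ltnW.
have := @Rintegral_ocitv_approx mu g M (x N) (x N.+1) e cg gM (ge N ^~ (ltnSn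
  N)).
have -> : mu `]x N, x N.+1]%classic = (F (x N.+1) - F (x N))%:E.
  exact: lebesgue_stieltjes_ocitv.
exact.
Qed.

Variables (C : R) (Lam : (R -> R) -> R).
Hypothesis C0 : 0 <= C.
Hypothesis LamD : forall f g : R -> R, continuous f -> continuous g ->
  Lam (fun y => f y + g y) = Lam f + Lam g.
Hypothesis LamZ : forall (a : R) (f : R -> R), continuous f ->
  Lam (fun y => a * f y) = a * Lam f.
Hypothesis Lam_le : forall f g : R -> R, continuous f -> continuous g ->
  (forall y, `|y| <= C -> f y <= g y) -> Lam f <= Lam g.
Hypothesis Lam1 : Lam (fun=> 1) = 1.

(** The measure is the Lebesgue-Stieltjes measure of [Lam_cdf Lam]. On a fine mesh
    both its integral of [g] and [Lam g] are close to the same Riemann-Stieltjes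
    sum. *)
Theorem riesz_interval : exists nu : probability (measurableTypeR R) R,
  forall (g : R -> R) (M : R), continuous g -> (forall y, `|g y| <= M) ->
    Rintegral nu setT g = Lam g.
Proof.
pose F := Lam_cdf Lam.
have Fnd : nondecreasing F := Lam_cdf_nondecreasing LamZ Lam_le Lam1.
have Frc : right_continuous F := Lam_cdf_right_continuous LamD LamZ Lam_le Lam1.
have F0 x : x < - C -> F x = 0 := @Lam_cdf0 _ _ _ LamZ Lam_le Lam1 x.
have F1 x : C <= x -> F x = 1 := @Lam_cdf1 _ _ _ LamZ Lam_le Lam1 x.
have FNy : F @ -oo --> (0 : R).
  apply/cvgrPdist_le => e e0; near=> y; rewrite F0 ?subrr ?normr0 ?ltW//.
  by near: y; apply: nbhs_ninfty_lt; exact: num_real.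
have Fy : F @ +oo --> (1 : R).
  apply/cvgrPdist_le => e e0; near=> y; rewrite F1 ?subrr ?normr0 ?ltW//.
  by near: y; apply: nbhs_pinfty_gt; exact: num_real.
pose M1 := isCumulative.Build R _ R F Fnd Frc.
pose M2 := isCumulativeBounded.Build R 0 1 F FNy Fy.
pose cF : cumulativeBounded (0 : R) (1 : R) := HB.pack F M1 M2.
pose nu : probability (measurableTypeR R) R := lebesgue_stieltjes_measure cF.
exists nu => g M cg gM.
have K0 : 0 < C + 1 by rewrite ltr_wpDl.
pose I := `]- (C + 1), C + 1]%classic : set (measurableTypeR R).
have mI : measurable I by exact: measurable_itv.
have nuI : nu I = 1%E.
  have -> : nu I = (F (C + 1) - F (- (C + 1)))%:E.
    by apply: (lebesgue_stieltjes_ocitv cF); lra.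
  rewrite (F1 (C + 1)) ?lerDl// (F0 (- (C + 1))) ?subr0//; lra.
have nuC : nu (~` I) = 0%E.
  by have := probability_setC nu mI; rewrite nuI subee.
have -> : Rintegral nu setT g = Rintegral nu I g.
  have := negligible_integral (measurableC mI) measurableT
    (fine_bounded_integrable nu measurableT cg gM) nuC.
  by rewrite setTD setCK /Rintegral => ->.
apply/eqP; rewrite -subr_eq0 -normr_le0; apply/ler_addgt0Pr => e e0;
  rewrite add0r.
have e3 : 0 < e / 3 by rewrite divr_gt0.
have cu : {within closed_disc (C + 1), continuous (fun z :
  R[i] => g (complex.Re z))}.
  apply: continuous_subspaceT => z.
  by apply: (@continuous_comp _ _ _ (@complex.Re R) g); [exact:
    continuous_Re|exact: cg].
have [del del0 hdel] := closed_disc_ucont cu e3.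
have guc y y' : `|y| <= C + 1 -> `|y'| <= C + 1 -> `|y - y'| < del ->
  `|g y - g y'| <= e / 3.
  move=> yK y'K yy; have := hdel y%:C y'%:C.
  by rewrite -rmorphB !normc_realc; exact.
(* A mesh [h] below [1] keeps the first ramp off [-C, C], and below [del] it keeps
   the oscillation of [g] below [e / 3]. *)
pose m := Num.min 1 (del / 2).
have m0 : 0 < m by rewrite lt_min ltr01 divr_gt0.
pose N := (Num.truncn (2 * (C + 1) / m)).+1.
pose h := 2 * (C + 1) / N%:R.
have N0 : 0 < N%:R :> R by rewrite ltr0n.
have h0 : 0 < h by rewrite divr_gt0// mulr_gt0.
have hm : h <= m.
  have X0 : 0 <= 2 * (C + 1) / m by rewrite divr_ge0 ?(ltW m0)// mulr_ge0// ltW.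
  have /andP[_ XN] := truncn_itv X0.
  by rewrite /h ler_pdivrMr// [leRHS]mulrC -ler_pdivrMr//; exact: ltW.
have h1 : h <= 1 by rewrite (le_trans hm)// ge_min lexx.
have hd : h < del.
  by rewrite (le_lt_trans hm)// (le_lt_trans (_ : m <= del / 2))//
    ?ge_min ?lexx ?orbT// ltr_pdivrMr//; lra.
pose x i := - (C + 1) + i%:R * h.
have xS i : x i.+1 = x i + h by rewrite /x -natr1 mulrDl mul1r addrA.
have xN : x N = C + 1 by rewrite /x /h mulrC divfK ?gt_eqF//; ring.
have xx i : x i <= x i.+1 by rewrite xS lerDl ltW.
have xK i : (i <= N)%N -> `|x i| <= C + 1.
  move=> iN; rewrite ler_norml /x lerDl mulr_ge0 ?(ltW h0)//=
    -[leRHS]xN /x lerD2l.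
  by rewrite ler_pM2r// ler_nat.
have x0 : x 0%N = - (C + 1) by rewrite /x mul0r addr0.
pose S := \sum_(0 <= i < N) g (x i.+1) * (F (x i.+1) - F (x i)).
(* One third for the ramps, one for the summation by parts. *)
have s1 : `|Lam g - S| <= e / 3 + e / 3.
  apply: (Lam_riemann_sum LamD LamZ Lam_le Lam1 (h := h)) => //.
  - by rewrite h0.
  - by rewrite -/(x N) xN lerDl.
  - exact: ltW.
  - move=> y i yC iN yx; apply: guc; rewrite ?xK//; last exact: le_lt_trans hd.
    by rewrite (le_trans yC)// lerDl.
  - move=> i iN; apply: guc; rewrite ?xK// ?(ltnW iN)//.
    by rewrite -/(x i.+1) -/(x i) xS addrAC subrr add0r gtr0_norm.
have s2 : `|Rintegral nu I g - S| <= e / 3.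
  have := @Rintegral_riemann_sum cF g M (e / 3) x N cg gM xx.
  have e1 : cF (C + 1) = 1 by apply: F1; rewrite lerDl.
  have e2 : cF (- (C + 1)) = 0 by apply: F0; lra.
  rewrite x0 xN e1 e2 subr0 mulr1.
  apply => i y iN /andP[xy yx]; apply: guc; rewrite ?xK//.
    rewrite ler_norml; have := xK _ iN; have := xK _ (ltnW iN).
    by rewrite !ler_norml => /andP[? ?] /andP[? ?]; lra.
  by rewrite ltr_norml; move: xy yx; rewrite xS; lra.
rewrite -(subrK S (Rintegral nu I g)) -addrA (le_trans (ler_normD _ _))//.
rewrite [X in _ + X]distrC (le_trans (lerD s2 s1))//; lra.
Unshelve. all: by end_near. Qed.

End RieszMeasure.

(** * Weak limits for real roots *)

Section Weierstrass.
Variable R : realType.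

(** The Chebyshev recursion [z^(k+2) = 2 Re(z) z^(k+1) - |z|^2 z^k]. *)
Lemma chebyshev (C : R) k : exists T : {poly R}, forall z : R[i], normc z = C ->
  complex.Re (z ^+ k) = T.[complex.Re z].
Proof.
suff : (exists T : {poly R}, forall z : R[i], normc z = C ->
  complex.Re (z ^+ k) = T.[complex.Re z]) /\
  (exists T : {poly R}, forall z : R[i], normc z = C ->
    complex.Re (z ^+ k.+1) = T.[complex.Re z]).
  by case.
elim: k => [|k [[T hT] [T' hT']]].
  split; first by exists 1 => z _; rewrite hornerC.
  by exists 'X => z _; rewrite expr1 hornerX.
split; first by exists T'.
exists (2 *: 'X * T' - (C ^+ 2) *: T) => z zC.
rewrite !hornerE -hT// -hT'// -zC sqr_normcE !exprS.
by case: z {zC} => x y; case: (_ ^+ k) => a b /=; ring.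
Qed.

(** A continuous function of the abscissa is approximated on the circle by
    [Re Q]; averaging over [z] and its conjugate leaves a combination of the
    [Re (z^k)], that is, a polynomial in the abscissa. *)
Lemma weierstrass_approx (C : R) (phi : R -> R) : 0 < C -> continuous phi ->
  forall e : R, 0 < e -> exists P : {poly R},
    forall x, `|x| <= C -> `|phi x - P.[x]| <= e.
Proof.
move=> C0 cphi e e0.
have cu : {within closed_disc C, continuous (fun z :
  R[i] => phi (complex.Re z))}.
  apply: continuous_subspaceT => z.
  by apply: (@continuous_comp _ _ _ (@complex.Re R) phi); [exact:
    continuous_Re|exact: cphi].
have [Q hQ] := continuous_circle_approx C0 cu e0.
have [T hT] := choice (chebyshev C).
exists (\sum_(k < size Q) complex.Re Q`_k *: T k) => x xC.
have x2 : 0 <= C ^+ 2 - x ^+ 2.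
  by rewrite subr_ge0 -[x ^+ 2]real_normK ?num_real// lerXn2r// ?nnegrE// ltW.
have [z zC zx] : exists2 z : R[i], normc z = C & complex.Re z = x.
  exists (x +i* Num.sqrt (C ^+ 2 - x ^+ 2)) => //.
  by rewrite /= sqr_sqrtr// addrC subrK sqrtr_sqr gtr0_norm.
have zC' : normc z^*%C = C by rewrite normc_conj.
have PE : (\sum_(k < size Q) complex.Re Q`_k *: T k).[x] =
    (complex.Re Q.[z] + complex.Re Q.[z^*%C]) / 2.
  rewrite horner_sum (horner_coef Q z) (horner_coef Q z^*%C) !cRe_sum -big_split
    /= mulr_suml.
  apply: eq_bigr => k _; rewrite hornerZ -zx -(hT k)//.
  rewrite -(rmorphXn (@conjc R)) !cReM; case: (z ^+ k) (Q`_k) => a b [a' b'] /=;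
    by field.
have h1 := hQ _ zC; have h2 := hQ _ zC'.
have zx' : complex.Re z^*%C = x by rewrite -zx; case: (z).
rewrite zx in h1; rewrite zx' in h2.
rewrite PE; move: h1 h2; rewrite !ler_norml => /andP[? ?] /andP[? ?].
by apply/andP; split; lra.
Qed.

End Weierstrass.

Section RealRoots.
Variable R : realType.

(** The types fix the sigma-algebras on both sides. *)
Definition real_line (x : measurableTypeR R) : borelC R := (x : R)%:C.

Lemma continuous_real_line : continuous (fun x : R => x%:C).
Proof.
move=> x; apply/cvgrPdist_lt => e; rewrite ltcE /= => /andP[/eqP eI e0].
near=> y; suff : normc (x%:C - y%:C) < complex.Re e.
  by rewrite normr_normc ltcE /= eI eqxx.
rewrite -rmorphB normc_realc; near: y.
exact: (@cvgrPdist_lt _ _ _ (nbhs x) _ id x).1 cvg_id _ e0.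
Unshelve. all: by end_near. Qed.

Lemma measurable_real_line : measurable_fun setT real_line.
Proof.
have := @measurability _ _ (measurableTypeR R) (borelC R) setT real_line
  (@open R[i]) erefl; apply.
move=> _ [V oV <-]; rewrite setTI; apply: open_measurable.
by apply: (open_comp _ oV) => x _; exact: continuous_real_line.
Qed.

HB.instance Definition _ := isMeasurableFun.Build _ _ _ _ real_line
  measurable_real_line.

Variables (C : R) (S : nat -> seq R[i]).
Hypothesis C0 : 0 <= C.
Hypothesis S_gt0 : forall n, (0 < size (S n))%N.
Hypothesis S_le : forall n, {in S n, forall z, normc z <= C}.
Hypothesis S_real : forall n, {in S n, forall z, z = (complex.Re z)%:C}.
Hypothesis S_Re : forall k, cvgn (fun n => avg (S n) (fun z => complex.Re (z ^+
  k))).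
Hypothesis S_Im : forall k, cvgn (fun n => avg (S n) (fun z => complex.Im (z ^+
  k))).

Lemma avg_real_cvg (phi : R -> R) : continuous phi ->
  cvgn (fun n => avg (S n) (fun z => phi (complex.Re z))).
Proof.
move=> cphi.
apply: (avg_approx_cvg S_gt0 S_Re S_Im (D := [set z | z = (complex.Re z)%:C /\
  normc z <= C + 1])).
  by move=> n z zS; split; [exact: S_real zS|rewrite (le_trans (S_le zS))//
    lerDl].
move=> e e0; have C10 : 0 < C + 1 by rewrite ltr_wpDl.
have [P hP] := weierstrass_approx C10 cphi e0.
exists (map_poly (real_complex R) P) => z [zR zC].
by rewrite {2}zR horner_map /= hP// (le_trans (normc_le_Re z)).
Qed.

Definition limit_functional (phi : R -> R) : R :=
  limn (fun n => avg (S n) (fun z => phi (complex.Re z))).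

(** On real points the averages of every continuous function converge, by the
    Weierstrass theorem; their limit is a positive functional, which
    [riesz_interval] turns into a measure on the line. *)
Lemma real_weak_limit : exists nu : probability (borelC R) R,
  forall h : R[i] -> R, continuous h -> (exists M : R, forall z, `|h z| <= M) ->
    avg (S n) h @[n --> \oo] --> Rintegral nu setT h.
Proof.
have cavg (phi : R -> R) (cphi : continuous phi) := avg_real_cvg cphi.
have LamD (f g : R -> R) : continuous f -> continuous g ->
    limit_functional (fun y => f y + g y) = limit_functional f +
      limit_functional g.
  move=> cf cg; rewrite /limit_functional -limD; [|exact: cavg|exact: cavg].
  by congr (limn _); apply/funext => n; rewrite avgD.
have LamZ (a : R) (f : R -> R) : continuous f ->
    limit_functional (fun y => a * f y) = a * limit_functional f.
  move=> cf; rewrite /limit_functional.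
  rewrite (_ : (fun n => _) = fun n => a * avg (S n) (fun z =>
    f (complex.Re z))).
    by apply: cvg_lim => //; apply: cvgMl_tmp; exact: cavg.
  by apply/funext => n; rewrite avgZ.
have Lam_le (f g : R -> R) : continuous f -> continuous g ->
    (forall y, `|y| <= C -> f y <= g y) -> limit_functional f <=
      limit_functional g.
  move=> cf cg fg; apply: ler_lim; [exact: cavg|exact: cavg|].
  apply: nearW => n; apply: le_avg => z zS; apply: fg.
  exact: le_trans (normc_le_Re z) (S_le zS).
have Lam1 : limit_functional (fun=> 1) = 1.
  rewrite /limit_functional (_ : (fun n => _) = fun=> 1) ?lim_cst//.
  by apply/funext => n; rewrite avg_cst.
have [mu hmu] := riesz_interval C0 LamD LamZ Lam_le Lam1.
exists (distribution mu real_line) => h ch [M hM].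
have chR : continuous (fun x : R => h x%:C).
  move=> x; apply: (@continuous_comp _ _ _ (fun x : R => x%:C) h); last exact:
    ch.
  exact: continuous_real_line.
have -> : Rintegral (distribution mu real_line) setT h =
  limit_functional (fun x => h x%:C).
  rewrite -(hmu _ M)//; rewrite /Rintegral; congr fine.
  apply: integral_distribution.
    apply/measurable_EFinP; apply: within_continuous_measurable.
    exact: continuous_subspaceT.
  exact: (fine_bounded_integrable mu measurableT chR (fun x => hM x%:C)).
rewrite (_ : (fun n => _) = fun n => avg (S n) (fun z => h (complex.Re z)%:C)).
  exact: cavg.
by apply/funext => n; apply: eq_avg => z /S_real <-.
Qed.

End RealRoots.

(** * Limits of the root measures *)

Section Conclusions.
Variable R : realType.
Implicit Types s : seq R[i].

Lemma measurable_closed_disc (C : R) : measurable (closed_disc C :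
  set (borelC R)).
Proof.
rewrite -[closed_disc C]setCK; apply: measurableC; apply: sub_sigma_algebra.
by apply: closed_openC; exact: closed_closed_disc.
Qed.

Lemma cintegral_uniform s (D : set (borelC R)) (g : R[i] -> R[i]) :
  measurable D -> {within D, continuous (fun z => complex.Re (g z))} ->
  {within D, continuous (fun z => complex.Im (g z))} -> {in s, forall z, D z} ->
  cintegral (uniform_measure s) D g =
    (avg s (fun z => complex.Re (g z))) +i* (avg s (fun z => complex.Im (g z))).
Proof. by move=> mD cR cI sD; rewrite /cintegral !Rintegral_uniform. Qed.

Lemma continuous_Im_horner (Q : {poly R[i]}) :
  continuous (fun w : R[i] => complex.Im Q.[w]).
Proof.
have -> : (fun w : R[i] => complex.Im Q.[w]) =
    (fun w => complex.Re (((0 -i* 1)%:P * Q).[w])).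
  apply/funext => w; rewrite hornerM hornerC; case: (Q.[w]) => a b /=.
  by rewrite mul0r sub0r mulNr mul1r opprK.
exact: continuous_Re_horner.
Qed.

Lemma within_continuous_comp (D : set R[i]) (g : R[i] -> R[i]) (p : R[i] -> R) :
  continuous p -> {within D, continuous g} -> {within D, continuous (p \o g)}.
Proof.
move=> cp cg z; apply: (@continuous_comp (subspace D) _ _ g p); first exact: cg.
exact: cp.
Qed.

Lemma ln_prod (I : eqType) (r : seq I) (F : I -> R) :
  {in r, forall i, 0 < F i} -> ln (\prod_(i <- r) F i) = \sum_(i <- r) ln (F i).
Proof.
elim: r => [|i r ih] F0; first by rewrite !big_nil ln1.
have Fr : {in r, forall i, 0 < F i} by move=> j jr; apply: F0;
  rewrite inE jr orbT.
rewrite !big_cons lnM ?ih// posrE; first by apply: F0; rewrite inE eqxx.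
by rewrite big_seq prodr_gt0.
Qed.

Lemma continuous_ln_dist (C : R) (xi : R[i]) : C < normc xi ->
  {within closed_disc C, continuous (fun z => ln (normc (xi - z)))}.
Proof.
move=> Cxi; apply/subspace_continuousP => z; rewrite closed_discE /= => zC.
have p0 : 0 < normc (xi - z).
  by apply: lt_le_trans (normc_sub_le _ _); rewrite subr_gt0 (le_lt_trans zC).
suff cz : {for z, continuous (fun z => ln (normc (xi - z)))} by apply:
  cvg_within_filter; exact: cz.
apply: (@continuous_comp _ _ _ (fun z => normc (xi - z)) (@ln R)); last exact:
  continuous_ln.
apply: lipschitz_continuous => w w'.
have lip a b : normc (xi - a) - normc (xi - b) <= normc (a - b).
  apply: (le_trans (normc_sub_le _ _)).
  by rewrite normcBC (_ : xi - b - (xi - a) = a - b)//; ring.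
by rewrite ler_norml lerNl opprB lip normcBC lip.
Qed.

End Conclusions.

Theorem theorem3p1 (R : realType)
    (f : sgraph -> {poly R[i]}) (hf : lbet_graph_poly f)
    (C : R) (hC : root_bound f C)
    (c : nat -> sgraph -> R[i]) (hc : power_sum_coeffs f c)
    (G : nat -> sgraph) (d : nat -> R)
    (hadm : admissible_seq G d)
    (hd : d n @[n --> \oo] --> +oo)
    (hconv : convergent_seq G d \/
       forall F : sgraph, gconnected F -> c #|F|.-1 F != 0 ->
         cvgn (fun n => hom_density F (G n) (d n))) :
  let nu n := root_measure f (G n) (d n) in
  [/\ forall k : nat,
        cintegral (nu n) setT (fun z => z ^+ k) @[n --> \oo] -->
        \sum_(F in conn_classes k.+1)
          c k (graph_of F) * (lim_density G d (graph_of F))%:C,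
      forall g : R[i] -> R[i],
        {within closed_disc C, continuous g} ->
        harmonic_on (open_disc C) g ->
        cvgn (fun n => cintegral (nu n) (closed_disc C) g),
      forall xi : R[i], C%:C < `|xi| ->
        exists2 l : R, 0 < l &
          (complex.Re `|(f (G n)).[xi * (d n)%:C]|) `^ (#|G n|%:R^-1) / d n
            @[n --> \oo] --> l &
      (forall n z, root (f (G n)) z -> z \is Num.real) ->
        weakly_converges nu].
Proof.
have [f_monic _ _ _ _] := hf.
pose S n := scaled_roots f (G n) (d n).
have d0 n : 0 < d n := admissible_gt0 hadm n.
have dn0 n : d n != 0 by rewrite gt_eqF.
have G0 n : (0 < #|G n|)%N by have [] := hadm n.
have sizeS n : size (S n) = #|G n| := size_scaled_roots f_monic (G n) (d n).
have S0 n : (0 < size (S n))%N by rewrite sizeS.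
have SC n : {in S n, forall z, normc z <= C} :=
  scaled_roots_le f_monic hC (hadm n).
have C0 : 0 <= C := root_bound_ge0 f_monic hC (hadm 0%N).
have mom k := moment_cvg f_monic hc hadm hd hconv k.
have S_Re k : cvgn (fun n => avg (S n) (fun z => complex.Re (z ^+ k))).
  under eq_fun do rewrite avg_Re_moment//.
  by apply/cvg_ex; eexists; exact: cvg_cRe (mom k).
have S_Im k : cvgn (fun n => avg (S n) (fun z => complex.Im (z ^+ k))).
  under eq_fun do rewrite avg_Im_moment//.
  by apply/cvg_ex; eexists; exact: cvg_cIm (mom k).
have harm_cvg (u : R[i] -> R) : {within closed_disc C, continuous u} ->
    (forall z, normc z < C -> discretely_harmonic u z) ->
      cvgn (fun n => avg (S n) u).
  move=> cu hu; apply: (avg_approx_cvg S0 S_Re S_Im SC) => e e0.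
  exact: harmonic_poly_approx.
have inD n : {in S n, forall z, closed_disc C z}.
  by move=> z zS; rewrite closed_discE; exact: SC zS.
split.
- move=> k; rewrite (_ : (fun n => _) = fun n => moment f k (G n) (d n));
  first exact: mom.
  apply/funext => n; rewrite cintegral_uniform//; last 2 first.
  + apply: continuous_subspaceT.
    have := @continuous_Re_horner R 'X^k; under eq_fun do rewrite hornerXn;
      exact.
  + apply: continuous_subspaceT.
    have := @continuous_Im_horner R 'X^k; under eq_fun do rewrite hornerXn;
      exact.
  by rewrite -/(S n) avg_Re_moment// avg_Im_moment//; case: moment.
- move=> g cg [hR hI].
  have cR := within_continuous_comp (@continuous_Re R) cg.
  have cI := within_continuous_comp (@continuous_Im R) cg.
  have lR := harm_cvg _ cR (harmonic2_discrete hR).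
  have lI := harm_cvg _ cI (harmonic2_discrete hI).
  have /cvg_ex[a al] := lR; have /cvg_ex[b bl] := lI.
  apply/cvg_ex; exists (a +i* b).
  rewrite (_ : (fun n => _) = fun n =>
    (avg (S n) (fun z => complex.Re (g z))) +i* (avg (S n) (fun z =>
      complex.Im (g z)))).
    exact: cvg_complex.
  apply/funext => n; rewrite cintegral_uniform//; [exact:
    measurable_closed_disc|exact: inD].
- move=> xi; rewrite normr_normc ltcR => Cxi.
  (* [f] at [xi d] is the product of the [d |xi - z|] over the scaled roots [z],
     so the quantity is the exponential of an average of [u]. *)
  pose u z := ln (normc (xi - z)).
  have cu := continuous_ln_dist Cxi.
  have hu z : normc z < C -> discretely_harmonic u z.
    move=> zC; apply: discretely_harmonic_ln; apply: contraTneq Cxi => <-.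
    by rewrite -leNgt ltW.
  have /cvg_ex[l al] := harm_cvg u cu hu.
  exists (expR l); first exact: expR_gt0.
  rewrite (_ : (fun n => _) = fun n => expR (avg (S n) u)).
    by apply: (continuous_cvg _ _ al); exact: continuous_expR.
  apply/funext => n; rewrite normr_normc /=.
  have xi0 : {in S n, forall z, 0 < normc (xi - z)}.
    move=> z /SC zC; apply: lt_le_trans (normc_sub_le _ _).
    by rewrite subr_gt0 (le_lt_trans zC).
  have fE : normc (f (G n)).[xi * (d n)%:C] = \prod_(z <- S n) (d n * normc (xi
    - z)).
    rewrite (poly_rootsE f_monic) horner_prod big_map.
    elim/big_rec2 : _ => [|z x y _ ih]; first by rewrite normc1.
    rewrite normcM ih hornerXsubC; congr (_ * _).
    rewrite -[X in _ = X * _](gtr0_norm (d0 n)) -normc_realc -normcM mulrBr.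
    by rewrite mulrC (mulrC _ (z / _)) divfK// (inj_eq (@complexI R) _ 0).
  have prod0 : 0 < \prod_(z <- S n) (d n * normc (xi - z)).
    by rewrite big_seq prodr_gt0// => z zS; rewrite mulr_gt0// xi0.
  rewrite fE /powR gt_eqF// ln_prod; last by move=> z zS; rewrite mulr_gt0//
    xi0.
  rewrite -[X in _ / X](lnK (d0 n : d n \in Num.pos)) -expRN -expRD; congr expR.
  rewrite big_seq (eq_bigr (fun z => ln (d n) + u z)); last first.
    by move=> z zS; rewrite lnM ?posrE ?xi0 ?d0//.
  rewrite -big_seq big_split /= mulrDr [_^-1 * \sum_(z <- S n) u z]mulrC -sizeS
    -/(avg (S n) u).
  rewrite addrAC -[RHS]add0r; congr (_ + _).
  by have := @avg_cst R (S n) (ln (d n)) (S0 n); rewrite /avg mulrC => ->;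
    rewrite subrr.
- move=> realroots.
  have S_real n : {in S n, forall z, z = (complex.Re z)%:C}.
    move=> _ /mapP[z + ->]; rewrite mem_poly_roots//
      => /realroots /complex_realP[x ->].
    by rewrite -fmorphV -rmorphM.
  have [nu hnu] := real_weak_limit C0 S0 SC S_real S_Re S_Im.
  exists nu => h ch hM.
  rewrite (_ : (fun n => _) = fun n => avg (S n) h); first exact: hnu.
  apply/funext => n; rewrite [LHS]Rintegral_uniform//.
  exact: continuous_subspaceT.
Qed.
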